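(* Fix $\eta>1$. There exist a numerical constant $c$ and a constant $c_\eta$ depending only on $\eta$ such that the following holds for every $p\ge3$. Let $\theta^*\in\mathbb R^p$, $\sigma>0$, $\Sigma\in\mathcal U(\eta)$, $\delta\in(0,1)$ and $\mathbf a_1,\mathbf a_2,\mathbf a_3>0$ satisfy $c[\mathbf a_2\|\theta^*\|_0+\log(4/\delta)]\le m$, and let $S\subset\{1,\dots,p\}$ be a fixed set satisfying property $\mathbf S[\mathbf a_1,\mathbf a_2,\mathbf a_3]$. Let $\underline c_*\ge\sqrt2\,\mathbf a_1+11\eta^2(\mathbf a_3\vee1)\sqrt{\log(4e/\delta)}$. Then: if $\|\theta^*\|_0\le k_0$, $\mathbb P_{\theta^*,\Sigma,\sigma}[\phi^{(th)}[S;\underline c_*]=1]\le\delta$; if $\|\theta^*\|_0>k_0$ and $$d_2^2(\theta^*,\mathbb B_0[k_0])\ge c_\eta\Big[1+\mathbf a_3^2\|\theta^*\|_0\frac{\log p}{m}\Big]\Big[\mathbf a_3^2\sqrt{\log(4/\delta)}+\underline c_*^2\Big]\sigma^2\frac{(\|\theta^*\|_0-k_0)\log p}{m},$$ then $\mathbb P_{\theta^*,\Sigma,\sigma}[\phi^{(th)}[S;\underline c_*]=1]\ge1-\delta$.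
   Context: Data: a sample $(Y^{(0)},\mathbf X^{(0)})$ of size $m$ from the model $Y^{(0)}=\mathbf X^{(0)}\theta^*+\sigma\epsilon$, rows of $\mathbf X^{(0)}\in\mathbb R^{m\times p}$ i.i.d. $\mathcal N(0,\Sigma)$, $\epsilon\sim\mathcal N(0,I_m)$ independent. $\mathcal U(\eta)$ is the set of $p\times p$ covariance matrices with all eigenvalues in $[\eta^{-1},\eta]$. $\mathbb B_0[k]=\{\theta:\|\theta\|_0\le k\}$, $d_2(\theta,A)=\inf_{u\in A}\|\theta-u\|_2$. For $u\in\mathbb R^p$ and $S\subset\{1,\ldots,p\}$, $u_S=(u_i\mathbf 1_{i\in S})_i$ and $\bar S$ is the complement. For $\mathbf a>0$ and $v\in\mathbb R^p$, $M(\mathbf a,v)=|\{i:0<|v_i|\le\mathbf a\sqrt{\log(p)/m}\}|$. A set $S$ satisfies property $\mathbf S[\mathbf a_1,\mathbf a_2,\mathbf a_3]$ if $|S|\le\mathbf a_2\|\theta^*\|_0$ and $\|\theta^*_{\bar S}\|_2^2\le\mathbf a_3^2\sigma^2M(\mathbf a_1,\theta^*/\sigma)\log(p)/m$. Given $S$, $\hat\theta_{ls,S}\in\arg\min_{\theta:\,\mathrm{supp}(\theta)\subset S}\|Y^{(0)}-\mathbf X^{(0)}\theta\|_2^2$ and $\hat\sigma_S^2=\frac1m\|Y^{(0)}-\mathbf X^{(0)}\hat\theta_{ls,S}\|_2^2$. For $u\in\mathbb R^p$ and $c>0$, $N[c;u]=|\{i:|u_i|\ge c\sqrt{\log(p)/m}\}|$.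 The test $\phi^{(th)}[S;c]$ rejects (equals 1) iff $N[c;\hat\theta_{ls,S}/\hat\sigma_S]\ge k_0+1$. *)

(* Defs.v *)
From HB Require Import structures.
From mathcomp Require Import all_boot all_order all_algebra.
From mathcomp Require Import all_classical all_reals all_analysis.
Set Implicit Arguments. Unset Strict Implicit. Unset Printing Implicit Defensive.
Import Order.TTheory GRing.Theory Num.Theory.
Import numFieldNormedType.Exports.
Local Open Scope classical_set_scope.
Local Open Scope ring_scope.

Section Defs.
Context {R : realType}.

Definition l0norm (p : nat) (u : 'cV[R]_p) : nat := #|[set i | u i 0 != 0]|.

Definition sqnorm (n : nat) (u : 'cV[R]_n) : R := \sum_i (u i 0) ^+ 2.

Definition B0 (p k : nat) : set 'cV[R]_p := [set u | (l0norm u <= k)%N].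

Definition d2 (p : nat) (theta : 'cV[R]_p) (A : set 'cV[R]_p) : R :=
  inf [set Num.sqrt (sqnorm (theta - u)) | u in A].

Definition restr (p : nat) (S : {set 'I_p}) (u : 'cV[R]_p) : 'cV[R]_p :=
  \col_i (if i \in S then u i 0 else 0).

Definition Ueta (p : nat) (eta : R) (Sigma : 'M[R]_p) : Prop :=
  Sigma^T = Sigma /\
  forall a : R, eigenvalue Sigma a -> eta^-1 <= a /\ a <= eta.

Definition rate (p m : nat) : R := Num.sqrt (ln (p%:R) / m%:R).

Definition Mcount (p m : nat) (a : R) (v : 'cV[R]_p) : nat :=
  #|[set i | (0 < `|v i 0|) && (`|v i 0| <= a * rate p m)]|.

Definition propS (p m : nat) (theta : 'cV[R]_p) (sigma a1 a2 a3 : R)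
    (S : {set 'I_p}) : Prop :=
  (#|S|%:R <= a2 * (l0norm theta)%:R) /\
  sqnorm (restr (~: S) theta) <=
    a3 ^+ 2 * sigma ^+ 2 * (Mcount m a1 (sigma^-1 *: theta))%:R
      * ln (p%:R) / m%:R.

Definition ls_selection (m p : nat) (S : {set 'I_p})
    (est : 'M[R]_(m, p) -> 'cV[R]_m -> 'cV[R]_p) : Prop :=
  forall X Y,
    (forall i, i \notin S -> est X Y i 0 = 0) /\
    (forall theta : 'cV[R]_p, (forall i, i \notin S -> theta i 0 = 0) ->
       sqnorm (Y - X *m est X Y) <= sqnorm (Y - X *m theta)).

Definition sigma_hat (m p : nat) (est : 'M[R]_(m, p) -> 'cV[R]_m -> 'cV[R]_p)
    (X : 'M[R]_(m, p)) (Y : 'cV[R]_m) : R :=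
  Num.sqrt (sqnorm (Y - X *m est X Y) / m%:R).

Definition Ncount (p m : nat) (c : R) (u : 'cV[R]_p) : nat :=
  #|[set i | c * rate p m <= `|u i 0|]|.

Definition phi_th (m p k0 : nat) (est : 'M[R]_(m, p) -> 'cV[R]_m -> 'cV[R]_p)
    (c : R) (X : 'M[R]_(m, p)) (Y : 'cV[R]_m) : bool :=
  (k0.+1 <= Ncount m c ((sigma_hat est X Y)^-1 *: est X Y))%N.

Definition iid_std_normal d (Omega : measurableType d) (P : probability Omega R)
    (I : finType) (f : I -> Omega -> R) : Prop :=
  (forall i, measurable_fun setT (f i)) /\
  forall B : I -> set R, (forall i, measurable (B i)) ->
    P (\bigcap_i (f i @^-1` B i)) = (\prod_(i : I) normal_prob 0 1 (B i))%E.

End Defs.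

(* Main.v *)
Require Import Defs.
From HB Require Import structures.
From mathcomp Require Import all_boot all_order all_algebra.
From mathcomp Require Import all_classical all_reals all_analysis.
From mathcomp Require Import measurable_realfun ring lra.

(** Everything happens on one event, of probability at least [1 - delta], on
    which the design is well behaved; there both claims are deterministic.
    Writing [that - theta_S = bias + sigma * nu], with [nu] the least-squares
    regression of the noise on the columns in [S], the event provides:
    - [|G x|^2 >= m/2 |x|^2] for the Gaussian matrix [G = (Z, eps)] and all [x]
      in the span of the columns in [S], of [A theta_Sbar] and of the noise
      direction, a space of dimension at most [|S| + 2].  This bounds below both
      the restricted eigenvalues and [shat^2] (by [sigma^2 / 2]).  A union bound
      over a lattice of mesh [1 / (2 sqrt K)] suffices: rounding [x] to a lattice
      point so that its mean is preserved changes the quadratic form by at most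
      [h^2/4] times the sum of the squared column norms, so that no bound on
      the operator norm is needed;
    - upper bounds on [|X theta_Sbar|^2] and [|X theta_Sbar + sigma eps|^2];
    - [|nu_i| <= 2 eta L sqrt (log p / m)], by a Gaussian tail conditional on [Z].
    The correlation between the columns in [S] and [X theta_Sbar] is harmless:
    [bias] is only bounded in Euclidean norm, by [2 eta |theta_Sbar|], so that
    at most [M(a1, theta / sigma)] of its coordinates can cause a detection, which
    is the number of nonzero coordinates that the test is allowed to miss.  Under
    the separation hypothesis [M(a1, theta / sigma) < |theta|_0 - k0], because
    otherwise [d2] would be realised by discarding small coordinates only. *)
Import Order.TTheory GRing.Theory Num.Theory.
Local Open Scope classical_set_scope.
Local Open Scope ring_scope.

Section Development.
Set Implicit Arguments. Unset Strict Implicit. Unset Printing Implicit Defensive.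
Import numFieldNormedType.Exports.
(** * Gaussian integrals *)

Section NormalIntegrals.
Context {R : realType}.
Local Notation mu := (@lebesgue_measure R).
Implicit Types (f F : R -> \bar R) (a b c m s : R).

(** A Radon-Nikodym derivative is only determined almost everywhere; it may be replaced by
    [normal_pdf] because both have the same integral over every measurable set. *)
Lemma ge0_integral_normal_prob m s f : s != 0 ->
  measurable_fun setT f -> (forall x, 0 <= f x)%E ->
  (\int[normal_prob m s]_x f x = \int[mu]_x (f x * (normal_pdf m s x)%:E))%E.
Proof.
move=> s0 mf f0.
have dom := normal_prob_dominates m s.
rewrite -(Radon_Nikodym_SigmaFinite.change_of_variables dom)//=.
have mrn : measurable_fun setT
    (Radon_Nikodym_SigmaFinite.f (normal_prob m s) mu).
  exact: measurable_int (Radon_Nikodym_SigmaFinite.f_integrable dom).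
have mpdf : measurable_fun setT (fun x => (normal_pdf m s x)%:E).
  by apply/measurable_EFinP; exact: measurable_normal_pdf.
apply: ae_eq_integral => //.
- exact: emeasurable_funM.
- exact: emeasurable_funM.
- apply: ae_eqe_mul2l; apply: integral_ae_eq => //=.
  + exact: Radon_Nikodym_SigmaFinite.f_integrable.
  + by move=> E _ mE; rewrite -(Radon_Nikodym_SigmaFinite.f_integral dom).
Qed.

Lemma measurable_affine a c : measurable_fun setT (fun v : R => a * v + c).
Proof.
by apply: measurable_funD => //; apply: measurable_funM.
Qed.

(** Uniqueness of Lebesgue measure: [|a|] times its image under [v |-> a * v + c] gives every
    interval its length. For negative [a] the preimage of a half-open interval is half-open on the
    other side. *)
Lemma ge0_integral_affine a c F : a != 0 ->
  measurable_fun setT F -> (forall x, 0 <= F x)%E ->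
  (\int[mu]_x F x = (`|a|)%:E * \int[mu]_v F (a * v + c)%R)%E.
Proof.
move=> a0 mF F0.
pose phi : measurableTypeR R -> measurableTypeR R := fun v => a * v + c.
have mphi : measurable_fun setT phi by exact: measurable_affine.
pose nu : {measure set (measurableTypeR R) -> \bar R} :=
  measure_function_pushforward__canonical__measure_function_Measure mu mphi.
have na0 : 0 <= `|a| by [].
pose m' := mscale (NngNum na0) nu.
have mm' : forall A, measurable A -> mu A = m' A.
  apply: lebesgue_measure_unique => _ [[x y] _ <-]/=.
  rewrite /m' /mscale/= /pushforward/=.
  rewrite lebesgue_measure_itv/= lte_fin.
  have [ap|an] := ltP 0 a.
    have -> : phi @^-1` `]x, y] = `](x - c) / a, (y - c) / a]%classic.
      apply/seteqP; split => v /=; rewrite !in_itv/= /phi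
        ltr_pdivrMr// ler_pdivlMr// => /andP[? ?]; apply/andP; split; lra.
    rewrite lebesgue_measure_itv/= lte_fin ltr_pM2r ?invr_gt0// ltrD2r.
    case: ifP => _; last by rewrite mule0.
    by rewrite gtr0_norm// -EFinB -EFinM; congr EFin; field.
  have {}an : a < 0 by rewrite lt_neqAle a0.
  have -> : phi @^-1` `]x, y] = `[(y - c) / a, (x - c) / a[%classic.
    apply/seteqP; split => v /=; rewrite !in_itv/= /phi
      ler_ndivrMr// ltr_ndivlMr// => /andP[? ?]; apply/andP; split; lra.
  rewrite lebesgue_measure_itv/= lte_fin ltr_nM2r ?invr_lt0// ltrD2r.
  case: ifP => _; last by rewrite mule0.
  by rewrite ltr0_norm// -EFinB -EFinM; congr EFin; field.
transitivity (\int[m']_x F x)%E.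
  by apply: eq_measure_integral => A mA _; exact: mm'.
rewrite ge0_integral_mscale//=; congr (_ * _)%E.
by rewrite /nu/= (ge0_integral_pushforward mphi mu measurableT).
Qed.

Lemma normal_peakE s : 0 < s -> normal_peak s = (s * Num.sqrt (pi *+ 2))^-1.
Proof.
move=> s0; rewrite /normal_peak -mulrnAr sqrtrM ?sqr_ge0//.
by rewrite sqrtr_sqr gtr0_norm.
Qed.

Lemma normal_pdf_expE m s x : 0 < s ->
  normal_pdf m s x =
  (s * Num.sqrt (pi *+ 2))^-1 * expR (- (x - m) ^+ 2 / (s ^+ 2 *+ 2)).
Proof. by move=> s0; rewrite normal_pdfE ?gt_eqF// normal_peakE. Qed.

Lemma sqrt_2pi_neq0 : Num.sqrt (pi *+ 2) != 0 :> R.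
Proof. by rewrite gt_eqF// sqrtr_gt0 mulrn_wgt0// pi_gt0. Qed.

Lemma measurable_normal_pdf_mean (b s : R) : 0 < s ->
  measurable_fun setT (fun z : R * R => normal_pdf (b * z.1) s z.2).
Proof.
move=> s0; under eq_fun do rewrite normal_pdf_expE//.
apply: measurable_funM => //; apply: measurableT_comp => //.
apply: measurable_funM => //; apply: measurableT_comp => //.
apply: measurable_funX; apply: measurable_funB => //.
exact: measurable_funM.
Qed.

Lemma ge0_integral_normal_affine a c F : a != 0 ->
  measurable_fun setT F -> (forall x, 0 <= F x)%E ->
  (\int[normal_prob 0 1]_v F (a * v + c)%R =
   \int[mu]_y (F y * (normal_pdf c `|a| y)%:E))%E.
Proof.
move=> a0 mF F0; have na0 : 0 < `|a| by rewrite normr_gt0.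
have mpdf : measurable_fun setT (fun x => (normal_pdf c `|a| x)%:E).
  by apply/measurable_EFinP; exact: measurable_normal_pdf.
have mFa : measurable_fun setT (fun v => F (a * v + c)%R).
  by apply: measurableT_comp => //; exact: measurable_affine.
rewrite (ge0_integral_normal_prob 0 (oner_neq0 R) mFa); last by [].
have mG : measurable_fun setT (fun y => F y * (normal_pdf c `|a| y)%:E)%E.
  exact: emeasurable_funM.
have G0 y : (0 <= F y * (normal_pdf c `|a| y)%:E)%E.
  by rewrite mule_ge0// lee_fin normal_pdf_ge0.
rewrite (ge0_integral_affine c a0 mG G0) -ge0_integralZl; first last.
- by rewrite lee_fin.
- by move=> x _; exact: G0.
- apply: (@measurableT_comp _ _ _ _ _ _
    (fun y => F y * (normal_pdf c `|a| y)%:E)%E) => //; exact: measurable_affine.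
- exact: measurableT.
apply: eq_integral => v _; rewrite muleCA -EFinM; congr (_ * (_)%:E)%E.
rewrite !normal_pdf_expE// expr1n mul1r subr0 addrK mulrA.
have -> : `|a| * (`|a| * Num.sqrt (pi *+ 2))^-1 = (Num.sqrt (pi *+ 2))^-1 :> R.
  by field; rewrite sqrt_2pi_neq0 gt_eqF.
congr (_ * expR _); rewrite real_normK ?num_real//; field; exact: a0.
Qed.

(* Completing the square in [u] exhibits the density of [a * v + b * u]. *)
Lemma normal_pdf_convolution (b s t u y : R) : 0 < s -> 0 < t ->
  t ^+ 2 = s ^+ 2 + b ^+ 2 ->
  normal_pdf 0 1 u * normal_pdf (b * u) s y =
  normal_pdf 0 t y * normal_pdf (b * y / t ^+ 2) (s / t) u.
Proof.
move=> s0 t0 tE; rewrite !normal_pdf_expE ?divr_gt0//.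
rewrite mulrACA [RHS]mulrACA -!expRD; congr (_ * expR _).
  by field; rewrite sqrt_2pi_neq0 !gt_eqF.
have t20 : s ^+ 2 + b ^+ 2 != 0 by rewrite -tE gt_eqF// exprn_gt0.
rewrite !expr_div_n tE; field.
by rewrite t20 gt_eqF.
Qed.

(** Rotation invariance in the plane. By Tonelli the integral in [u] is taken first; after
    [normal_pdf_convolution] it is the total mass of a Gaussian density, and the centred density of
    standard deviation [t] remains. The case [a = 0] is separate because the inner variable then has
    no density. *)
Lemma ge0_integral_normal_comb a b F :
  measurable_fun setT F -> (forall x, 0 <= F x)%E ->
  (\int[normal_prob 0 1]_u \int[normal_prob 0 1]_v F (a * v + b * u)%R =
   \int[normal_prob 0 1]_u F (Num.sqrt (a ^+ 2 + b ^+ 2) * u)%R)%E.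
Proof.
move=> mF F0.
have sc0 c G : c != 0 -> measurable_fun setT G -> (forall x, 0 <= G x)%E ->
    (\int[normal_prob 0 1]_u G (c * u)%R =
     \int[mu]_y (G y * (normal_pdf 0 `|c| y)%:E))%E.
  move=> c0 mG G0; rewrite -ge0_integral_normal_affine//.
  by apply: eq_integral => v _; rewrite addr0.
have [->|a0] := eqVneq a 0.
  rewrite expr0n/= add0r sqrtr_sqr.
  under eq_integral => u _.
    under eq_integral do rewrite mul0r add0r.
    rewrite integral_cst//= probability_setT mule1.
    over.
  have [->|b0] := eqVneq b 0; first by rewrite normr0.
  rewrite (sc0 _ _ b0 mF F0) (sc0 `|b| F _ mF F0) ?normr_id//.
  by rewrite normr_eq0.
set t := Num.sqrt _; have s0 : 0 < `|a| by rewrite normr_gt0.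
have t0 : 0 < t.
  by rewrite sqrtr_gt0 ltr_wpDr ?sqr_ge0// exprn_even_gt0.
have tE : t ^+ 2 = `|a| ^+ 2 + b ^+ 2.
  by rewrite sqr_sqrtr ?addr_ge0 ?sqr_ge0// real_normK ?num_real.
under eq_integral do rewrite (ge0_integral_normal_affine _ a0 mF F0).
have mpb := measurable_normal_pdf_mean b s0.
have mH : measurable_fun setT
    (fun z : R * R => F z.2 * (normal_pdf (b * z.1) `|a| z.2)%:E)%E.
  apply: emeasurable_funM; first exact: measurableT_comp.
  exact/measurable_EFinP.
have H0 (z : R * R) : (0 <= F z.2 * (normal_pdf (b * z.1) `|a| z.2)%:E)%E.
  by rewrite mule_ge0// lee_fin normal_pdf_ge0.
have mI : measurable_fun setT
    (fun x : R => \int[mu]_y (F y * (normal_pdf (b * x) `|a| y)%:E))%E.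
  exact: (@measurable_fun_fubini_tonelli_F _ _ _ _ R mu _ mH H0).
rewrite (ge0_integral_normal_prob 0 (oner_neq0 R) mI); last first.
  by move=> x; apply: integral_ge0 => y _; exact: (H0 (x, y)).
pose K (z : R * R) := (F z.2 * (normal_pdf (b * z.1) `|a| z.2)%:E
  * (normal_pdf 0 1 z.1)%:E)%E.
have mK : measurable_fun setT K.
  apply: emeasurable_funM => //; apply/measurable_EFinP.
  by apply: (measurableT_comp (measurable_normal_pdf 0 1)).
have K0 z : (0 <= K z)%E by rewrite mule_ge0// lee_fin normal_pdf_ge0.
transitivity (\int[mu]_x \int[mu]_y K (x, y))%E.
  apply: eq_integral => x _; rewrite /K /= ge0_integralZr//; first last.
  - by rewrite lee_fin normal_pdf_ge0.
  - by move=> y _; exact: (H0 (x, y)).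
  - exact: (measurableT_comp mH (measurable_pair1 _)).
transitivity (\int[mu]_y \int[mu]_x K (x, y))%E.
  exact: (@fubini_tonelli _ _ _ _ R mu mu K mK K0).
rewrite (sc0 t F (lt0r_neq0 t0) mF F0).
apply: eq_integral => y _; rewrite gtr0_norm//.
under eq_integral do
  rewrite /K/= -muleA -EFinM mulrC (normal_pdf_convolution _ _ s0 t0 tE) EFinM.
have mp2 : measurable_fun [set: R]
    (fun x => (normal_pdf (b * y / t ^+ 2) (`|a| / t) x)%:E).
  by apply/measurable_EFinP; exact: measurable_normal_pdf.
rewrite ge0_integralZl//; last 2 first.
- exact: emeasurable_funM.
- by move=> x _; rewrite mule_ge0// lee_fin normal_pdf_ge0.
rewrite ge0_integralZl//; last 2 first.
- by move=> x _; rewrite lee_fin normal_pdf_ge0.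
- by rewrite lee_fin normal_pdf_ge0.
by rewrite integral_normal_pdf mule1.
Qed.

(** Exponential tilting turns the standard density into [expR (t ^+ 2 / 2)] times the density
    centred at [t]. *)
Lemma integral_normal_exp t :
  (\int[normal_prob 0 1]_u (expR (t * u))%:E = (expR (t ^+ 2 / 2))%:E :> \bar R)%E.
Proof.
have mf : measurable_fun [set: R] (fun u => (expR (t * u))%:E).
  by apply/measurable_EFinP; apply: measurableT_comp => //; exact: measurable_funM.
rewrite (ge0_integral_normal_prob 0 (oner_neq0 R) mf); last first.
  by move=> x; rewrite lee_fin expR_ge0.
under eq_integral => u _.
  rewrite -EFinM (_ : expR (t * u) * normal_pdf 0 1 u =
    expR (t ^+ 2 / 2) * normal_pdf t 1 u) ?EFinM; last first.
    rewrite !normal_pdf_expE// [LHS]mulrCA [RHS]mulrCA -!expRD.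
    by congr (_ * expR _); field.
  over.
rewrite ge0_integralZl ?integral_normal_pdf ?mule1//.
- by apply/measurable_EFinP; exact: measurable_normal_pdf.
- by move=> x _; rewrite lee_fin normal_pdf_ge0.
Qed.

(** The exponent is parametrised by the standard deviation [s] of the tilted law: the integrand is
    [s] times the density [normal_pdf 0 s]. Both signs of the exponent are covered, [s < 1] for
    lower tails and [s > 1] for upper tails. *)
Lemma integral_normal_exp_sqr s : 0 < s ->
  (\int[normal_prob 0 1]_u (expR ((1 - s ^- 2) / 2 * u ^+ 2))%:E = s%:E :> \bar R)%E.
Proof.
move=> s0.
have mf : measurable_fun [set: R] (fun u => (expR ((1 - s ^- 2) / 2 * u ^+ 2))%:E).
  apply/measurable_EFinP; apply: measurableT_comp => //.
  by apply: measurable_funM => //; exact: measurable_funX.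
rewrite (ge0_integral_normal_prob 0 (oner_neq0 R) mf); last first.
  by move=> x; rewrite lee_fin expR_ge0.
under eq_integral => u _.
  rewrite -EFinM (_ : expR ((1 - s ^- 2) / 2 * u ^+ 2) * normal_pdf 0 1 u =
    s * normal_pdf 0 s u) ?EFinM; last first.
    rewrite !normal_pdf_expE// [LHS]mulrCA -!expRD [RHS]mulrA.
    congr (_ * expR _); first by field; rewrite sqrt_2pi_neq0 gt_eqF.
    by field; rewrite gt_eqF.
  over.
rewrite ge0_integralZl ?integral_normal_pdf ?mule1//.
- by apply/measurable_EFinP; exact: measurable_normal_pdf.
- by move=> x _; rewrite lee_fin normal_pdf_ge0.
- by rewrite lee_fin ltW.
Qed.

End NormalIntegrals.

(** * Standard Gaussian vectors *)

Section GaussianVector.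
Context {R : realType} {I : finType}.
Local Notation T := (#|I|.-tuple R).
Local Notation N01 := (@normal_prob R 0 1).

Definition entry (i : I) (t : T) : R := tnth t (enum_rank i).

Definition upd (i : I) (x : R) (t : T) : T :=
  [tuple (if k == enum_rank i then x else tnth t k) | k < #|I|].

Definition rect (B : I -> set R) : set T := [set t | forall i, B i (entry i t)].

(** Only rectangles are prescribed; they form a generating pi-system, so the law is determined. *)
Definition std_gaussian (mu : probability T R) : Prop :=
  forall B : I -> set R, (forall i, measurable (B i)) ->
    mu (rect B) = (\prod_(i : I) N01 (B i))%E.

Lemma measurable_entry i : measurable_fun setT (entry i).
Proof. exact: measurable_tnth. Qed.

Lemma entry_upd i j x t : entry j (upd i x t) = if j == i then x else entry j t.
Proof. by rewrite /entry tnth_mktuple (inj_eq enum_rank_inj). Qed.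

Lemma measurable_upd i :
  measurable_fun setT (fun z : measurableTypeR R * T => upd i z.1 z.2).
Proof.
apply/measurable_fun_tnthP => k.
rewrite (_ : _ \o _ = if k == enum_rank i then fst else
   (fun z : R * T => tnth z.2 k)); last first.
  by apply/funext => z /=; rewrite tnth_mktuple; case: ifP.
case: ifP => _ //.
by apply: (measurableT_comp (measurable_tnth k)).
Qed.

Definition rects : set (set T) :=
  [set rect B | B in [set B | forall i, measurable (B i)]].

Lemma measurable_rect B : (forall i, measurable (B i)) -> measurable (rect B).
Proof.
move=> mB; have -> : rect B = \big[setI/setT]_(i : I) (entry i @^-1` B i).
  rewrite -bigcap_seq; apply/seteqP; split => [t tB i _|t tB i]; first exact: tB.
  by apply: tB => /=; rewrite mem_index_enum.
apply: bigsetI_measurable => i _; rewrite -[X in measurable X]setTI.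
exact: measurable_entry.
Qed.

Lemma tuple_measurableE : measurable = <<s rects>> :> set (set T).
Proof.
rewrite eqEsubset; split; last first.
  apply: smallest_sub; first exact: sigma_algebra_measurable.
  by move=> _ [B mB <-]; exact: measurable_rect.
apply: smallest_sub; first exact: smallest_sigma_algebra.
rewrite -bigcup_seq => A [k _ [B mB <-]]; apply: sub_sigma_algebra.
exists (fun i => if i == enum_val k then B else setT).
  by move=> i; case: ifP => _ //; exact: measurableT.
rewrite setTI; apply/seteqP; split => t /=.
  by move/(_ (enum_val k)); rewrite eqxx /entry enum_valK.
by move=> Bt i; case: ifP => // /eqP ->; rewrite /entry enum_valK.
Qed.

Lemma setI_closed_rects : setI_closed rects.
Proof.
move=> _ _ [A mA <-] [B mB <-]; exists (fun i => A i `&` B i).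
  by move=> i; exact: measurableI.
apply/seteqP; split => t; first by move=> tAB; split => i; case: (tAB i).
by move=> [tA tB] i; split.
Qed.

Section Resampling.
Context (mu : probability T R) (Hmu : std_gaussian mu).

(** Redrawing one coordinate independently preserves the law: the image of [N01 \x mu] under [upd i]
    agrees with [mu] on rectangles. All later Gaussian computations integrate one coordinate at a
    time through this identity. *)
Lemma std_gaussian_resample i (H : T -> \bar R) :
  measurable_fun setT H -> (forall t, 0 <= H t)%E ->
  (\int[mu]_t H t = \int[mu]_t \int[N01]_x H (upd i x t))%E.
Proof.
move=> mH H0.
pose nu : {measure set T -> \bar R} :=
  measure_function_pushforward__canonical__measure_function_Measure
    (N01 \x mu)%E (measurable_upd i).
have munu A : measurable A -> mu A = nu A.
  apply: (measure_unique rects (fun=> setT)) => //.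
  - exact: tuple_measurableE.
  - exact: setI_closed_rects.
  - move=> _; exists (fun=> setT); first by move=> j; exact: measurableT.
    by apply/seteqP; split.
  - by rewrite bigcup_const//; exists 0%N.
  - move=> _ [B mB <-]; rewrite /nu/= /pushforward/=; have muB := Hmu mB. rewrite [LHS]muB.
    pose B' j := if j == i then setT else B j.
    have mB' j : measurable (B' j).
      by rewrite /B'; case: ifP => _ //; exact: measurableT.
    (* The old value at [i] is overwritten, so the constraint at [i] falls on the fresh draw and
       [B'] leaves that slot free. *)
    have -> : (fun z : R * T => upd i z.1 z.2) @^-1` rect B = B i `*` rect B'.
      apply/seteqP; split => [[x t] /= xt|[x t] /= [Bx tB'] j].
        split; first by have := xt i; rewrite entry_upd eqxx.
        by move=> j; have := xt j; rewrite /B' entry_upd; case: ifP.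
      by have := tB' j; rewrite /B' entry_upd; case: ifP => [/eqP ->|].
    have muB' : mu (rect B') = (\prod_(j : I) N01 (B' j))%E by exact: Hmu.
    rewrite product_measure1E//; last exact: measurable_rect.
    rewrite [X in (_ = _ * X)%E]muB' (bigD1 i)//= [in RHS](bigD1 i)//= /B' eqxx probability_setT mul1e.
    by congr (_ * _)%E; apply: eq_bigr => j /negPf ->.
  - exact: mB.
  - by move=> k; apply: (le_lt_trans (@probability_le1 _ _ _ mu _ measurableT)); exact: ltry.
transitivity (\int[nu]_t H t)%E.
  by apply: eq_measure_integral => A mA _; exact: munu.
rewrite /nu/= (ge0_integral_pushforward (measurable_upd i) _ measurableT)//.
rewrite preimage_setT.
have mK : measurable_fun setT (fun z : measurableTypeR R * T => H (upd i z.1 z.2)).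
  exact: measurableT_comp (measurable_upd i).
rewrite (fubini_tonelli1 (m1 := N01) (m2 := mu) _ mK)//=.
exact: (@fubini_tonelli _ _ _ _ R N01 mu _ mK).
Qed.

Lemma measurable_lincomb (J : seq I) (x : I -> R) :
  measurable_fun setT (fun t : T => \sum_(j <- J) x j * entry j t).
Proof.
by apply: measurable_sum => j; apply: measurable_funM => //; exact: measurable_entry.
Qed.

(** Induction on [J]: the head coordinate is redrawn and averaged into a new function [F'], and
    [ge0_integral_normal_comb] merges the two Gaussians at the end. The second argument of [F]
    carries whatever depends on the coordinates outside [J]. *)
Lemma std_gaussian_lincomb (J : seq I) (x : I -> R) (F : R -> T -> \bar R) :
  uniq J ->
  measurable_fun setT (fun z : measurableTypeR R * T => F z.1 z.2) ->
  (forall r t, 0 <= F r t)%E ->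
  (forall j y r t, j \in J -> F r (upd j y t) = F r t) ->
  (\int[mu]_t F (\sum_(j <- J) x j * entry j t)%R t =
   \int[mu]_t \int[N01]_u F (Num.sqrt (\sum_(j <- J) x j ^+ 2) * u)%R t)%E.
Proof.
elim: J F => [|j J IH] F /=.
  move=> _ mF F0 _; apply: eq_integral => t _; rewrite !big_nil sqrtr0.
  under eq_integral do rewrite mul0r.
  by rewrite integral_cst//= probability_setT mule1.
move=> /andP[jJ uJ] mF F0 FJ.
have mFt t : measurable_fun setT (F ^~ t).
  exact: (measurableT_comp mF (pair2_measurable t)).
have mH : measurable_fun setT (fun t => F (\sum_(k <- j :: J) x k * entry k t) t).
  apply: (measurableT_comp (f := fun z : measurableTypeR R * T => F z.1 z.2)
    (g := fun t => (\sum_(k <- j :: J) x k * entry k t, t))) => //.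
  by apply: measurable_fun_pair => //; exact: measurable_lincomb.
rewrite (std_gaussian_resample j mH); last by [].
pose F' (r : R) t := (\int[N01]_v F (x j * v + r)%R t)%E.
transitivity (\int[mu]_t F' (\sum_(k <- J) x k * entry k t)%R t)%E.
  apply: eq_integral => t _; apply: eq_integral => v _.
  rewrite FJ ?mem_head// big_cons entry_upd eqxx; congr (F (_ + _) t).
  apply: eq_big_seq => k kJ; rewrite entry_upd; case: eqP => // kj.
  by rewrite -kj kJ in jJ.
have mF' : measurable_fun setT (fun z : measurableTypeR R * T => F' z.1 z.2).
  pose K (z : (measurableTypeR R * T) * measurableTypeR R) :=
    F (x j * z.2 + z.1.1) z.1.2.
  have mK : measurable_fun setT K.
    apply: (measurableT_comp (f := fun z : measurableTypeR R * T => F z.1 z.2)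
      (g := fun z : (measurableTypeR R * T) * measurableTypeR R =>
              (x j * z.2 + z.1.1, z.1.2))) => //.
    apply: measurable_fun_pair; last exact: measurableT_comp.
    apply: measurable_funD; first exact: measurable_funM.
    exact: measurableT_comp.
  by apply: (@measurable_fun_fubini_tonelli_F _ _ _ _ R N01 _ mK) => z; exact: F0.
rewrite (IH F' uJ mF'); last 2 first.
- by move=> r t; apply: integral_ge0 => v _; exact: F0.
- move=> k y r t kJ; apply: eq_integral => v _; apply: FJ.
  by rewrite inE kJ orbT.
apply: eq_integral => t _.
rewrite (ge0_integral_normal_comb _ _ (mFt t)); last by [].
by rewrite big_cons sqr_sqrtr// sumr_ge0// => k _; exact: sqr_ge0.
Qed.

(** Distinct rows use disjoint entries, so the rows are integrated out in turn, each contributing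
    the factor [c], while the product over the others rides along as the second argument of [F]. *)
Lemma std_gaussian_rows (K J : finType) (idx : K -> J -> I) (x : J -> R)
    (psi : R -> R) (c : R) (s : seq K) :
  (forall k k' j j', idx k j = idx k' j' -> k = k' /\ j = j') ->
  measurable_fun setT psi -> (forall u, 0 <= psi u) ->
  (\int[N01]_u (psi (Num.sqrt (\sum_j x j ^+ 2) * u))%:E = c%:E)%E ->
  uniq s ->
  (\int[mu]_t (\prod_(k <- s) psi (\sum_j x j * entry (idx k j) t))%:E =
   (c ^+ size s)%:E)%E.
Proof.
move=> idx_inj mpsi psi0 cE.
have c0 : 0 <= c.
  by rewrite -lee_fin -cE; apply: integral_ge0 => u _; rewrite lee_fin.
pose y k t := \sum_j x j * entry (idx k j) t.
have my k : measurable_fun setT (y k).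
  by apply: measurable_sum => j; apply: measurable_funM => //; exact: measurable_entry.
have mprod s' : measurable_fun setT (fun t => \prod_(k <- s') psi (y k t)).
  by apply: measurable_prod => k _; exact: measurableT_comp.
have prod0 s' t : 0 <= \prod_(k <- s') psi (y k t) by apply: prodr_ge0.
elim: s => [|k s IH] /=.
  by move=> _; under eq_integral do rewrite big_nil; rewrite integral_cst//= probability_setT mule1.
move=> /andP[ks us].
pose F r t := (psi r * \prod_(l <- s) psi (y l t))%:E.
have idxk_inj : injective (idx k) by move=> j j' /idx_inj[].
(* The coefficients are moved from columns to entries; by injectivity of [idx k] the sum has a
   single term on the row. *)
pose x' i := \sum_(j | idx k j == i) x j.
have x'E j : x' (idx k j) = x j.
  by rewrite /x' (eq_bigl (pred1 j)) ?big_pred1_eq// => j'; rewrite (inj_eq idxk_inj).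
transitivity (\int[mu]_t F (\sum_(i <- [seq idx k j | j <- enum J]) x' i * entry i t)%R t)%E.
  apply: eq_integral => t _; rewrite big_cons /F big_map big_enum.
  by congr ((psi _ * _)%:E); apply: eq_bigr => j _; rewrite x'E.
rewrite (@std_gaussian_lincomb _ x' F); first last.
- move=> i z r t /mapP[j _ ->]; rewrite /F; congr ((_ * _)%:E).
  apply: eq_big_seq => l ls; congr psi; apply: eq_bigr => j' _.
  rewrite entry_upd; case: eqP => // /idx_inj[lk _].
  by rewrite -lk ls in ks.
- by move=> r t; rewrite lee_fin mulr_ge0.
- apply/measurable_EFinP; apply: measurable_funM.
    exact: (measurableT_comp mpsi).
  by apply: (measurableT_comp (mprod s)).
- by rewrite map_inj_uniq ?enum_uniq.
under eq_integral => t _.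
  rewrite big_map big_enum (eq_bigr (fun j => x j ^+ 2)); last by move=> j _; rewrite x'E.
  under eq_integral do rewrite /F EFinM.
  rewrite ge0_integralZr//; last 3 first.
  - by apply/measurable_EFinP; apply: (measurableT_comp mpsi); exact: measurable_funM.
  - by move=> u _; rewrite lee_fin.
  - by rewrite lee_fin.
  rewrite cE; over.
rewrite ge0_integralZl//; last 2 first.
- by apply/measurable_EFinP; exact: mprod.
- by move=> t _; rewrite lee_fin.
by rewrite IH// -EFinM exprS.
Qed.

(** A moment generating function conditional on the coordinates outside [e]: the weights may depend
    on those only. Each redrawn coordinate yields [expR (w k t ^+ 2 / 2)], which the induction
    stores in [Phi]. *)
Lemma std_gaussian_conditional_exp (K : finType) (e : K -> I) (w : K -> T -> R)
    (s : seq K) (Phi : T -> R) :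
  injective e -> (forall k, measurable_fun setT (w k)) ->
  (forall k l y t, w k (upd (e l) y t) = w k t) ->
  measurable_fun setT Phi -> (forall t, 0 <= Phi t) ->
  (forall l y t, Phi (upd (e l) y t) = Phi t) ->
  uniq s ->
  (\int[mu]_t (Phi t * expR (\sum_(k <- s) w k t * entry (e k) t))%:E =
   \int[mu]_t (Phi t * expR (\sum_(k <- s) w k t ^+ 2 / 2))%:E)%E.
Proof.
move=> e_inj mw we; elim: s Phi => [|k s IH] Phi mPhi Phi0 Phie /=.
  by move=> _; under eq_integral do rewrite big_nil; under [RHS]eq_integral do rewrite big_nil.
move=> /andP[ks us].
have mS s' : measurable_fun setT (fun t => expR (\sum_(k <- s') w k t * entry (e k) t)).
  apply: measurableT_comp => //; apply: measurable_sum => l.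
  by apply: measurable_funM => //; exact: measurable_entry.
rewrite (std_gaussian_resample (e k)); last 2 first.
- by apply/measurable_EFinP; apply: measurable_funM.
- by move=> t; rewrite lee_fin mulr_ge0// expR_ge0.
pose Phi' t := Phi t * expR (w k t ^+ 2 / 2).
transitivity (\int[mu]_t (Phi' t * expR (\sum_(l <- s) w l t * entry (e l) t))%:E)%E.
  apply: eq_integral => t _.
  under eq_integral => v _.
    rewrite Phie big_cons we entry_upd eqxx expRD mulrCA.
    rewrite (eq_big_seq (fun l => w l t * entry (e l) t)); last first.
      move=> l ls; rewrite we entry_upd (inj_eq e_inj); case: eqP => // lk.
      by rewrite -lk ls in ks.
    rewrite EFinM.
    over.
  have mE : measurable_fun [set: R] (fun v => (expR (w k t * v))%:E).
    by apply/measurable_EFinP; apply: measurableT_comp => //; exact: measurable_funM.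
  have E0 : (0 <= (Phi t * expR (\sum_(l <- s) w l t * entry (e l) t))%:E)%E.
    by rewrite lee_fin mulr_ge0// expR_ge0.
  rewrite (ge0_integralZr N01 measurableT mE _ E0); last first.
    by move=> u _; rewrite lee_fin expR_ge0.
  by rewrite integral_normal_exp -EFinM /Phi' mulrCA mulrA.
rewrite IH//.
- by apply: eq_integral => t _; rewrite big_cons /Phi' expRD mulrA.
- apply: measurable_funM => //; apply: measurableT_comp => //.
  by apply: measurable_funM => //; exact: measurable_funX.
- by move=> t; rewrite mulr_ge0// expR_ge0.
- by move=> l y t; rewrite /Phi' Phie we.
Qed.

End Resampling.
End GaussianVector.

(** * Linear algebra *)

Section DotProduct.
Context {R : realType}.

Definition dot n (u v : 'cV[R]_n) : R := \sum_i u i 0 * v i 0.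

Lemma dotE n (u v : 'cV[R]_n) : dot u v = (u^T *m v) 0 0.
Proof. by rewrite mxE; apply: eq_bigr => i _; rewrite mxE. Qed.

Lemma dotC n (u v : 'cV[R]_n) : dot u v = dot v u.
Proof. by apply: eq_bigr => i _; rewrite mulrC. Qed.

Lemma dotDl n (u v w : 'cV[R]_n) : dot (u + v) w = dot u w + dot v w.
Proof. by rewrite -big_split; apply: eq_bigr => i _; rewrite mxE mulrDl. Qed.

Lemma dotZl n a (u w : 'cV[R]_n) : dot (a *: u) w = a * dot u w.
Proof. by rewrite mulr_sumr; apply: eq_bigr => i _; rewrite mxE mulrA. Qed.

Lemma dotDr n (u v w : 'cV[R]_n) : dot w (u + v) = dot w u + dot w v.
Proof. by rewrite dotC dotDl !(dotC w). Qed.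

Lemma dotZr n a (u w : 'cV[R]_n) : dot w (a *: u) = a * dot w u.
Proof. by rewrite dotC dotZl dotC. Qed.

Lemma dotNr n (u w : 'cV[R]_n) : dot w (- u) = - dot w u.
Proof. by rewrite -scaleN1r dotZr mulN1r. Qed.

Lemma dot_mulmx m n (M : 'M[R]_(m, n)) u v : dot (M *m u) v = dot u (M^T *m v).
Proof. by rewrite !dotE trmx_mul mulmxA. Qed.

Lemma dot_delta n (u : 'cV[R]_n) j : dot u (delta_mx j 0) = u j 0.
Proof.
rewrite /dot (bigD1 j)//= mxE !eqxx mulr1 big1 ?addr0// => i /negPf ij.
by rewrite mxE ij mulr0.
Qed.

Lemma sqnormE n (u : 'cV[R]_n) : sqnorm u = dot u u.
Proof. by apply: eq_bigr => i _; rewrite expr2. Qed.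

Lemma sqnorm_ge0 n (u : 'cV[R]_n) : 0 <= sqnorm u.
Proof. by apply: sumr_ge0 => i _; exact: sqr_ge0. Qed.

Lemma sqnorm0 n : sqnorm (0 : 'cV[R]_n) = 0.
Proof. by apply: big1 => i _; rewrite mxE expr0n. Qed.

Lemma sqnorm_eq0 n (u : 'cV[R]_n) : (sqnorm u == 0) = (u == 0).
Proof.
apply/idP/eqP => [|->]; last by rewrite sqnorm0.
rewrite psumr_eq0 => [/allP u0|i _]; last exact: sqr_ge0.
apply/matrixP => i j; rewrite ord1 mxE.
by have := u0 i (mem_index_enum _); rewrite /= sqrf_eq0 => /eqP.
Qed.

Lemma sqnormZ n a (u : 'cV[R]_n) : sqnorm (a *: u) = a ^+ 2 * sqnorm u.
Proof. by rewrite !sqnormE dotZl dotZr mulrA expr2. Qed.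

Lemma sqnormD n (u v : 'cV[R]_n) :
  sqnorm (u + v) = sqnorm u + 2 * dot u v + sqnorm v.
Proof. by rewrite !sqnormE dotDl !dotDr (dotC v u); ring. Qed.

Lemma sqnorm_isometry m n (Q : 'M[R]_(m, n)) u : Q^T *m Q = 1%:M ->
  sqnorm (Q *m u) = sqnorm u.
Proof. by move=> QQ; rewrite !sqnormE dot_mulmx mulmxA QQ mul1mx. Qed.

Lemma sqr_coord_le n (u : 'cV[R]_n) i : u i 0 ^+ 2 <= sqnorm u.
Proof.
rewrite /sqnorm (bigD1 i)//= lerDl sumr_ge0// => j _; exact: sqr_ge0.
Qed.

(** The columns of [B] may be dependent: a column already in the span of [Q] adds no vector, hence
    only [k' <= k]. *)
Lemma gram_schmidt n k (B : 'M[R]_(n, k)) :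
  exists k', exists Q : 'M[R]_(n, k'), exists U : 'M[R]_(k', k),
  [/\ (k' <= k)%N, Q^T *m Q = 1%:M & B = Q *m U].
Proof.
elim: k B => [|k IH] B.
  exists 0%N, 0, 0; split=> //; first by apply/matrixP => -[].
  by apply/matrixP => i [].
move: B; rewrite -addn1 => B.
have [k' [Q [U [k'k QQ BE]]]] := IH (lsubmx B).
pose b := rsubmx B; pose v := b - Q *m (Q^T *m b).
have Qv : Q^T *m v = 0 by rewrite mulmxBr !mulmxA QQ mul1mx subrr.
have [v0|v0] := eqVneq v 0.
  exists k', Q, (row_mx U (Q^T *m b)); split=> //.
    by rewrite (leq_trans k'k)// leq_addr.
  rewrite mul_mx_row -BE -[LHS]hsubmxK; congr row_mx.
  by apply/eqP; rewrite -subr_eq0; apply/eqP.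
pose a := Num.sqrt (sqnorm v).
have a0 : a != 0.
  rewrite sqrtr_eq0 -ltNge lt_neqAle sqnorm_ge0 andbT eq_sym.
  by rewrite sqnorm_eq0.
have a2 : a * a = sqnorm v by rewrite -expr2 sqr_sqrtr// sqnorm_ge0.
exists (k' + 1)%N, (row_mx Q (a^-1 *: v)), (block_mx U (Q^T *m b) 0 a%:M).
split; first by rewrite leq_add2r.
  rewrite tr_row_mx mul_col_row QQ -scalemxAr Qv scaler0 linearZ/=.
  have -> : (a^-1 *: v^T) *m Q = 0.
    by rewrite -scalemxAl -[Q]trmxK -trmx_mul Qv linear0 scaler0.
  have -> : (a^-1 *: v^T) *m (a^-1 *: v) = 1%:M.
    rewrite -scalemxAl -scalemxAr scalerA; apply/matrixP => i j.
    rewrite !ord1 mxE -dotE -sqnormE -a2 mxE eqxx mulr1n.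
    by field.
  by rewrite -scalar_mx_block.
rewrite mul_row_block mulmx0 addr0 -BE -[LHS]hsubmxK; congr row_mx.
by rewrite mul_mx_scalar scalerA divff// scale1r /v addrC subrK.
Qed.

End DotProduct.

(** * Extreme eigenvalues of symmetric matrices *)

Section Rayleigh.
Context {R : realType}.

(** First-order optimality without derivatives: [e = - b / (|q| + 1)] makes the expression negative
    unless [b = 0]. *)
Lemma quad_ge0_lin0 (b q : R) :
  (forall e, 0 <= 2 * e * b + e ^+ 2 * q) -> b = 0.
Proof.
move=> H; apply/eqP; apply/negP => /negP b0.
have q1 : 0 < `|q| + 1 by rewrite ltr_wpDl.
have := H (- b / (`|q| + 1)); apply/negP; rewrite -ltNge.
rewrite (_ : _ + _ = b ^+ 2 / (`|q| + 1) ^+ 2 * (q - 2 * (`|q| + 1))); last first.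
  by field; rewrite gt_eqF.
rewrite pmulr_rlt0; last by rewrite divr_gt0 ?exprn_even_gt0//= gt_eqF.
by have := ler_norm q; have := normr_ge0 q; lra.
Qed.

(** The quadratic form attains its minimum on the compact unit sphere, and optimality at the
    minimiser is the eigenvector equation. *)
Lemma symmetric_min_eigenvalue n (S : 'M[R]_n.+1) : S^T = S ->
  exists2 a, eigenvalue S a & forall u, a * sqnorm u <= dot u (S *m u).
Proof.
move=> symS.
pose f (u : 'rV[R]_n.+1) : R := dot u^T (S *m u^T).
pose g (u : 'rV[R]_n.+1) : R := sqnorm u^T.
have gE u : g u = \sum_i u 0 i ^+ 2 by apply: eq_bigr => i _; rewrite mxE.
have fE u : f u = \sum_i u 0 i * \sum_j S i j * u 0 j.
  by apply: eq_bigr => i _; rewrite !mxE; congr (_ * _); apply: eq_bigr => j _; rewrite mxE.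
have cc i : continuous (fun u : 'rV[R]_n.+1 => u 0 i : R) by exact: coord_continuous.
have cg : continuous g.
  rewrite (_ : g = fun u => \sum_i u 0 i ^+ 2); last by apply/funext.
  apply: continuous_big => [|i _ u]; first exact: add_continuous.
  exact: (continuousM (cc i u) (cc i u)).
have cf : continuous f.
  rewrite (_ : f = fun u => \sum_i u 0 i * \sum_j S i j * u 0 j); last by apply/funext.
  apply: continuous_big => [|i _ u]; first exact: add_continuous.
  apply: (continuousM (cc i u)).
  move: u; apply: continuous_big => [|j _ u]; first exact: add_continuous.
  exact: (continuousM (@cst_continuous _ _ (S i j) u) (cc j u)).
pose A := [set u : 'rV[R]_n.+1 | g u = 1].
have A0 : A !=set0.
  exists (delta_mx 0 0); rewrite /A/= gE (bigD1 0)//= mxE !eqxx expr1n big1 ?addr0//.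
  by move=> i /negPf i0; rewrite mxE i0 andbF expr0n.
have cA : compact A.
  apply: bounded_closed_compact.
    exists 1; split; first exact: num_real.
    move=> M M1 u Au; rewrite /= [X in X <= _](_ : _ = mx_norm u)// mx_normrE.
    apply: bigmax_le; first lra.
    move=> [i j] _; rewrite ord1/= (le_trans _ (ltW M1))//.
    rewrite -(@ler_pXn2r _ 2) ?nnegrE// expr1n real_normK ?num_real//.
    by have := sqr_coord_le u^T j; rewrite mxE -/(g u) Au.
  rewrite (_ : A = g @^-1` [set 1])//.
  by apply: closed_comp; [move=> ? _; exact: cg|exact: closed_eq].
have [c /set_mem Ac minc] := EVT_min_rV A0 cA (continuous_subspaceT cf).
have {}minc u : f c * g u <= f u.
  have [u0|u0] := eqVneq (g u) 0.
    rewrite u0 mulr0; move/eqP: u0; rewrite sqnorm_eq0 => /eqP u0.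
    by rewrite /f u0 mulmx0 /dot big1// => i _; rewrite mxE mul0r.
  have gu : 0 < g u by rewrite lt_neqAle eq_sym u0 sqnorm_ge0.
  pose s := (Num.sqrt (g u))^-1.
  have s2 : s ^+ 2 = (g u)^-1 by rewrite exprVn sqr_sqrtr// ltW.
  have As : A (s *: u).
    by rewrite /A/= /g linearZ/= sqnormZ s2 -/(g u) mulVf.
  have := minc _ (mem_set As); rewrite {2}/f linearZ/= -scalemxAr dotZl dotZr mulrA.
  by rewrite -expr2 s2 -/(f u) ler_pdivlMl// mulrC.
exists (f c); last first.
  by move=> u; have := minc u^T; rewrite /f /g trmxK.
(* The residual of the eigenvector equation; perturbing [c] in the direction [w] itself has
   first-order term [sqnorm w], which must vanish. *)
have [w wE] : exists w, w = S *m c^T - f c *: c^T by eexists.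
have w0 : w = 0.
  apply/eqP; rewrite -sqnorm_eq0 sqnormE; apply/eqP.
  apply: (@quad_ge0_lin0 _ (dot w (S *m w) - f c * sqnorm w)) => e.
  have := minc (c^T + e *: w)^T; rewrite /f /g trmxK -subr_ge0.
  rewrite sqnormD sqnormZ mulmxDr -scalemxAr dotDl !dotDr !dotZl !dotZr.
  rewrite -/(f c) -/(g c) Ac.
  have -> : dot c^T (S *m w) = dot w (S *m c^T).
    by rewrite dotC dot_mulmx symS.
  have -> : dot w w = dot w (S *m c^T) - f c * dot c^T w.
    by rewrite [X in dot w X = _]wE dotDr dotNr dotZr (dotC w c^T).
  by rewrite /f; congr (_ <= _); ring.
apply/eigenvalueP; exists c.
  apply: trmx_inj; rewrite trmx_mul symS linearZ/=; apply/eqP.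
  by rewrite -subr_eq0 -wE; apply/eqP.
apply/eqP => c0; have : g c = 1 by [].
by rewrite gE c0 big1 => [|i _]; [lra|rewrite mxE expr0n].
Qed.

Lemma Ueta_sqnorm n (eta : R) (Sigma A : 'M[R]_n.+1) u :
  Ueta eta Sigma -> A^T *m A = Sigma ->
  eta^-1 * sqnorm u <= sqnorm (A *m u) /\ sqnorm (A *m u) <= eta * sqnorm u.
Proof.
move=> [symS evS] AA.
have AuE : sqnorm (A *m u) = dot u (Sigma *m u) by rewrite sqnormE dot_mulmx mulmxA AA.
split.
  have [a /evS[a1 _]] := symmetric_min_eigenvalue symS.
  move/(_ u); rewrite AuE; apply: le_trans.
  by rewrite ler_wpM2r// sqnorm_ge0.
(* The upper bound is the minimum principle for [- Sigma]. *)
have symN : (- Sigma)^T = - Sigma by rewrite linearN/= symS.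
have [a ev] := symmetric_min_eigenvalue symN.
move/(_ u); rewrite mulNmx dotNr -AuE => aN.
have /evS[_ a2] : eigenvalue Sigma (- a).
  have [v vE v0] := eigenvalueP ev; apply/eigenvalueP; exists v => //.
  by rewrite scaleNr -vE mulmxN opprK.
rewrite -lerN2 (le_trans _ aN)// -mulNr ler_wpM2r ?sqnorm_ge0//; lra.
Qed.

End Rayleigh.

(** * Lower bounds on quadratic forms from a lattice *)

Section Rounding.
Context {R : realType}.
Variables (m k : nat) (H : 'M[R]_(m, k)) (c L h : R).
Hypotheses (h0 : 0 < h) (L0 : 0 <= L).
Hypothesis HL : forall j, sqnorm (col j H) - c <= L.

Let q (y : 'cV[R]_k) := sqnorm (H *m y) - c * sqnorm y.

Lemma q_shift (y : 'cV[R]_k) j d :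
  q (y + d *: delta_mx j 0) =
  q y + 2 * d * (dot (H *m y) (col j H) - c * y j 0)
  + d ^+ 2 * (sqnorm (col j H) - c).
Proof.
rewrite /q mulmxDr -scalemxAr -colE !sqnormD !sqnormZ !dotZr dot_delta.
by rewrite [sqnorm (delta_mx j 0)]sqnormE dot_delta mxE !eqxx/=; ring.
Qed.

(* The average of [q] over the random rounding that preserves the mean of the
   j-th coordinate exceeds [q y] by at most the variance [h^2/4] times [L]. *)
Lemma round_coord (y : 'cV[R]_k) j : exists z : int,
  `|z%:~R - y j 0 / h| <= 1 /\
  q (y + (h * z%:~R - y j 0) *: delta_mx j 0) <= q y + L * h ^+ 2 / 4.
Proof.
pose l := Num.floor (y j 0 / h); pose t := y j 0 / h - l%:~R.
have /andP[lt0 lt1] := floor_itv (y j 0 / h).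
have t0 : 0 <= t by rewrite subr_ge0.
have t1 : t < 1 by rewrite ltrBlDl; move: lt1; rewrite intrD.
have yE : y j 0 = h * (l%:~R + t) by rewrite /t; field; rewrite gt_eqF.
set B := dot (H *m y) (col j H) - c * y j 0.
set a := sqnorm (col j H) - c.
have E0 : h * l%:~R - y j 0 = - (h * t) by rewrite yE; ring.
have E1 : h * (l + 1)%:~R - y j 0 = h * (1 - t) by rewrite yE intrD; ring.
have at4 : a * (t * (1 - t)) <= L / 4.
  apply: (@le_trans _ _ (L * (t * (1 - t)))).
    by rewrite ler_wpM2r ?HL// mulr_ge0// subr_ge0 ltW.
  rewrite ler_wpM2l// -subr_ge0.
  rewrite (_ : _ - _ = (t - 1 / 2) ^+ 2); [exact: sqr_ge0|by field].
have comb : (1 - t) * q (y + (h * l%:~R - y j 0) *: delta_mx j 0)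
   + t * q (y + (h * (l + 1)%:~R - y j 0) *: delta_mx j 0)
   <= q y + L * h ^+ 2 / 4.
  rewrite !q_shift -/B -/a E0 E1.
  have -> : (1 - t) * (q y + 2 * - (h * t) * B + (- (h * t)) ^+ 2 * a)
      + t * (q y + 2 * (h * (1 - t)) * B + (h * (1 - t)) ^+ 2 * a)
    = q y + h ^+ 2 * (a * (t * (1 - t))) by ring.
  rewrite lerD2l (le_trans (ler_wpM2l (sqr_ge0 h) at4))//.
  by rewrite le_eqVlt; apply/orP; left; apply/eqP; field.
have [low|high] := leP (q (y + (h * l%:~R - y j 0) *: delta_mx j 0))
  (q y + L * h ^+ 2 / 4).
  by exists l; split=> //; rewrite distrC ger0_norm// ltW.
exists (l + 1); split.
  have -> : (l + 1)%:~R - y j 0 / h = 1 - t :> R by rewrite /t intrD; ring.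
  by rewrite ger0_norm; lra.
rewrite leNgt; apply/negP => high'.
have := ltW high; have := ltW high'; move: high high' comb.
set A := q (y + _); set A' := q (y + _); set Z := _ + _ / 4 => *.
have : (1 - t) * Z + t * Z < (1 - t) * A + t * A'.
  by rewrite ltr_leD ?ltr_pM2l ?subr_gt0// ler_wpM2l.
by rewrite -mulrDl subrK mul1r; lra.
Qed.

Lemma round_all (x : 'cV[R]_k) : exists z : 'I_k -> int,
  (forall j, `|(z j)%:~R - x j 0 / h| <= 1) /\
  q (\col_j (h * (z j)%:~R)) <= q x + k%:R * (L * h ^+ 2 / 4).
Proof.
suff step i : (i <= k)%N -> exists z : 'I_k -> int,
    (forall j, `|(z j)%:~R - x j 0 / h| <= 1) /\
    q (\col_j (if (j < i)%N then h * (z j)%:~R else x j 0))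
    <= q x + i%:R * (L * h ^+ 2 / 4).
  have [z [zx qz]] := step k (leqnn k).
  exists z; split => //; apply: le_trans qz; rewrite le_eqVlt; apply/orP; left.
  by apply/eqP; congr q; apply/matrixP => i j; rewrite !mxE ltn_ord.
elim: i => [_|i IH ik].
  (* The floors are placeholders: before a coordinate is rounded, only the closeness bound reads its
     integer. *)
  exists (fun j => Num.floor (x j 0 / h)); split.
    move=> j; have /andP[lt0 lt1] := floor_itv (x j 0 / h).
    by rewrite distrC ger0_norm ?subr_ge0// lerBlDl ltW//;
      move: lt1; rewrite intrD.
  rewrite mul0r addr0 le_eqVlt; apply/orP; left; apply/eqP; congr q.
  by apply/matrixP => j' l; rewrite !mxE ord1.
have [z [zx qz]] := IH (ltnW ik).
pose j0 := Ordinal ik; set y := \col_j _ in qz.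
have yj0 : y j0 0 = x j0 0 by rewrite mxE ltnn.
have [w [wx qw]] := round_coord y j0.
exists (fun j => if j == j0 then w else z j); split.
  by move=> j; case: eqP => [->|_]; [rewrite -yj0|exact: zx].
rewrite -natr1 mulrDl mul1r addrA; apply: le_trans; last first.
  by apply: lerD; [exact: qz|exact: lexx].
apply: le_trans qw; rewrite le_eqVlt; apply/orP; left; apply/eqP; congr q.
apply/matrixP => j l; rewrite !mxE ord1 eqxx andbT.
have [->|jj0] := eqVneq j j0; first by rewrite /= ltnSn ltnn; ring.
have -> : (j < i.+1)%N = (j < i)%N.
  rewrite ltnS leq_eqVlt; case: eqP => //= ji.
  by case/eqP: jj0; apply/val_inj.
by rewrite mulr0 addr0.
Qed.

End Rounding.

Section Lattice.
Context {R : realType}.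

(* Integers of absolute value at most [n], as a sign and a modulus (so that zero
   is represented twice). *)
Definition latval n (a : bool * 'I_n.+1) : R := (-1) ^+ a.1 * (a.2 : nat)%:R.

(** An l1 ball: integers satisfy [|z| <= z ^ 2], so a squared Euclidean bound implies the l1 bound,
    and the latter is easy to count. *)
Definition lattice k n : {set {ffun 'I_k -> bool * 'I_n.+1}} :=
  [set z : {ffun 'I_k -> bool * 'I_n.+1} | (\sum_j (z j).2 <= n)%N].

Definition latpt k n (h : R) (z : {ffun 'I_k -> bool * 'I_n.+1}) : 'cV[R]_k :=
  \col_j (h * latval (z j)).

Lemma sum_half_pow n : \sum_(i < n) (2^-1 : R) ^+ i <= 2.
Proof.
suff -> : \sum_(i < n) (2^-1 : R) ^+ i = 2 - 2 * 2^-1 ^+ n.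
  by rewrite gerBl mulr_ge0// exprn_ge0.
elim: n => [|n IH]; first by rewrite big_ord0 expr0 mulr1 subrr.
by rewrite big_ord_recr/= IH exprS; field.
Qed.

(** Counting by exponential weights: a member has weight at least 1 when [z] is weighted by [2 ^ n]
    times the product of the [2 ^ (- |z_j|)]. The total weight factorises over coordinates, with two
    signs times a geometric sum of at most 2 in each. *)
Lemma card_lattice k n : (#|lattice k n|%:R <= 2 ^+ n * 4 ^+ k :> R).
Proof.
pose p (a : bool * 'I_n.+1) : R := 2^-1 ^+ a.2.
have p0 a : 0 <= p a by rewrite exprn_ge0.
have -> : #|lattice k n|%:R = \sum_(z in lattice k n) 1 :> R by rewrite sumr_const.
apply: (@le_trans _ _ (\sum_(z in lattice k n) 2 ^+ n * \prod_j p (z j))).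
  apply: ler_sum => z; rewrite inE => zn.
  rewrite /p -expr_sum exprVn ler_pdivlMr ?exprn_gt0// mul1r.
  by rewrite ler_eXn2l// ltr1n.
rewrite -mulr_sumr ler_wpM2l ?exprn_ge0//.
apply: (@le_trans _ _ (\sum_(z : {ffun 'I_k -> bool * 'I_n.+1}) \prod_j p (z j))).
  rewrite [leRHS](bigID (mem (lattice k n)))/= lerDl sumr_ge0// => z _.
  exact: prodr_ge0.
rewrite -(bigA_distr_bigA (fun _ a => p a)) prodr_const card_ord lerXn2r ?nnegrE//.
  by apply: sumr_ge0.
rewrite -(pair_bigA _ (fun (_ : bool) (i : 'I_n.+1) => (2^-1 : R) ^+ i))/=.
by rewrite big_bool/=; have := sum_half_pow n.+1; lra.
Qed.

(* The modulus bound [10 * K] is [2 |x|^2 / h^2 + 2 K] for [h = 1 / (2 sqrt K)]. *)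
Lemma lattice_lower_bound m k K (H : 'M[R]_(m, k)) (M : R) (x : 'cV[R]_k) :
  (k <= K)%N -> (0 < K)%N -> 0 <= M ->
  let h := (2 * Num.sqrt K%:R)^-1 in
  (forall j, sqnorm (col j H) <= 2 * M) ->
  (forall z, z \in lattice k (10 * K) ->
     5 / 8 * M * sqnorm (latpt h z) <= sqnorm (H *m latpt h z)) ->
  M / 2 * sqnorm x <= sqnorm (H *m x).
Proof.
move=> kK K0 M0 h Hcol Hlat.
have KR : 0 < K%:R :> R by rewrite ltr0n.
have h0 : 0 < h by rewrite invr_gt0 mulr_gt0// sqrtr_gt0.
have h2 : h ^+ 2 = (4 * K%:R)^-1.
  by rewrite exprVn exprMn sqr_sqrtr ?ltW//; congr (_^-1); ring.
wlog x1 : x / sqnorm x = 1.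
  move=> W; have [x0|x0] := eqVneq (sqnorm x) 0.
    by rewrite x0 mulr0 sqnorm_ge0.
  have sx : 0 < sqnorm x by rewrite lt_neqAle eq_sym x0 sqnorm_ge0.
  have s2 : (Num.sqrt (sqnorm x))^-1 ^+ 2 = (sqnorm x)^-1.
    by rewrite exprVn sqr_sqrtr// ltW.
  have := W ((Num.sqrt (sqnorm x))^-1 *: x).
  rewrite -scalemxAr !sqnormZ s2 mulVf// mulr1 => /(_ erefl).
  by rewrite ler_pdivlMl// mulrC.
have HL j : sqnorm (col j H) - 5 / 8 * M <= 11 / 8 * M.
  by have := Hcol j; lra.
have L0 : 0 <= 11 / 8 * M by rewrite mulr_ge0//; lra.
have [z [zx qz]] := round_all h0 L0 HL x.
have zn : (\sum_j `|z j| <= 10 * K)%N.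
  rewrite -(ler_nat R) natr_sum natrM.
  apply: (@le_trans _ _ (\sum_j (2 * (x j 0 / h) ^+ 2 + 2))).
    apply: ler_sum => j _; have := zx j; set s := x j 0 / h => zs.
    have -> : (`|z j|%N)%:R = `|(z j)%:~R| :> R by rewrite -intr_norm -abszE.
    have zz : `|(z j)%:~R : R| <= (z j)%:~R ^+ 2.
      rewrite -(real_normK (num_real _)) -intr_norm -abszE -!natrX ler_nat.
      by case: `|z j|%N => // a; rewrite expnS expn1 leq_pmulr.
    apply: (le_trans zz).
    have -> : (z j)%:~R = s + ((z j)%:~R - s) :> R by ring.
    have : ((z j)%:~R - s) ^+ 2 <= 1.
      by rewrite -(real_normK (num_real _)) expr_le1.
    by set d := _ - s; have := sqr_ge0 (s - d); nra.
  rewrite big_split/= sumr_const card_ord -mulr_sumr.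
  under eq_bigr do rewrite expr_div_n h2 invrK.
  rewrite -mulr_suml -/(sqnorm x) x1 mul1r -mulr_natr.
  have : (k%:R <= K%:R :> R) by rewrite ler_nat.
  lra.
have zjn j : (`|z j| < (10 * K).+1)%N.
  by rewrite ltnS (leq_trans _ zn)// (bigD1 j)//= leq_addr.
pose w := [ffun j => (z j < 0, Ordinal (zjn j))] : {ffun 'I_k -> bool * 'I_(10 * K).+1}.
have wz : latpt h w = \col_j (h * (z j)%:~R).
  apply/matrixP => j l; rewrite !mxE /latval ffunE/=; congr (_ * _).
  have -> : (`|z j|%N)%:R = `|(z j)%:~R| :> R by rewrite -intr_norm -abszE.
  have [zj0|zj0] := ltP (z j) 0; first by rewrite expr1 ltr0_norm ?ltrz0//; ring.
  by rewrite expr0 mul1r ger0_norm// ler0z.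
have wl : w \in lattice k (10 * K).
  by rewrite inE; apply: leq_trans zn; apply: leq_sum => j _; rewrite ffunE.
have := Hlat _ wl; rewrite wz -subr_ge0 => /le_trans /(_ qz).
rewrite x1 !mulr1 h2 => final.
have kKr : k%:R / K%:R <= 1 :> R by rewrite ler_pdivrMr// mul1r ler_nat.
(* The rounding loss, with [11/8 = 2 - 5/8]; it fits because [11/128 <= 5/8 - 1/2]. *)
have : k%:R * (11 / 8 * M * (4 * K%:R)^-1 / 4) <= 11 / 128 * M.
  rewrite (_ : _ * _ = 11 / 128 * M * (k%:R / K%:R)); last by field; rewrite gt_eqF.
  by rewrite ler_piMr//; lra.
lra.
Qed.

End Lattice.

(** * Tail bounds *)

Section Tails.
Context {R : realType}.

Lemma measurable_superlevel d (T : measurableType d) (f : T -> R) (a : R) :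
  measurable_fun setT f -> measurable [set t | a <= f t].
Proof.
move=> mf; rewrite -[X in measurable X]setTI.
rewrite (_ : [set t | _] = f @^-1` `[a, +oo[%classic); first exact: mf.
by apply/seteqP; split => t /=; rewrite in_itv/= andbT.
Qed.

Lemma measurable_strict_superlevel d (T : measurableType d) (f : T -> R) (a : R) :
  measurable_fun setT f -> measurable [set t | a < f t].
Proof.
move=> mf; rewrite -[X in measurable X]setTI.
rewrite (_ : [set t | _] = f @^-1` `]a, +oo[%classic); first exact: mf.
by apply/seteqP; split => t /=; rewrite in_itv/= andbT.
Qed.

Lemma measurable_strict_sublevel d (T : measurableType d) (f : T -> R) (a : R) :
  measurable_fun setT f -> measurable [set t | f t < a].
Proof.
move=> mf; rewrite -[X in measurable X]setTI.
rewrite (_ : [set t | _] = f @^-1` `]-oo, a[%classic); first exact: mf.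
by apply/seteqP; split => t /=; rewrite in_itv.
Qed.

Lemma markov_exp d (T : measurableType d) (mu : probability T R) (Z : T -> R)
    (a c : R) : measurable_fun setT Z ->
  (\int[mu]_t (expR (Z t))%:E <= c%:E)%E ->
  (mu [set t | (a <= Z t)%R] <= (c * expR (- a))%:E)%E.
Proof.
move=> mZ Zc.
have mA : measurable [set t | a <= Z t].
  exact: measurable_superlevel.
have mE : measurable_fun setT (fun t => (expR (Z t))%:E).
  by apply/measurable_EFinP; exact: measurableT_comp.
rewrite expRN -[X in (X <= _)%E]mul1e EFinM.
rewrite lee_pdivlMr ?expR_gt0// mul1e muleC -integral_cst//.
apply: le_trans Zc; apply: (@le_trans _ _ (\int[mu]_(t in [set t | (a <= Z t)%R]) (expR (Z t))%:E)%E).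
  apply: ge0_le_integral => //.
  - by move=> t _; rewrite lee_fin expR_ge0.
  - exact: measurable_funTS.
  - by move=> t /= aZ; rewrite lee_fin ler_expR.
by apply: ge0_subset_integral => //; move=> t _; rewrite lee_fin expR_ge0.
Qed.

Context {I : finType}.
Local Notation T := (#|I|.-tuple R).
Context (mu : probability T R) (Hmu : std_gaussian mu).

Section ChiSquare.
Context (K J : finType) (idx : K -> J -> I) (x : J -> R).
Hypothesis idx_inj : forall k k' j j', idx k j = idx k' j' -> k = k' /\ j = j'.

Definition rowsq (t : T) : R := \sum_k (\sum_j x j * entry (idx k j) t) ^+ 2.

Lemma measurable_rowsq : measurable_fun setT rowsq.
Proof.
apply: measurable_sum => k; apply: measurable_funX; apply: measurable_sum => j.
by apply: measurable_funM => //; exact: measurable_entry.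
Qed.

Lemma rowsq_eq0 t : \sum_j x j ^+ 2 = 0 -> rowsq t = 0.
Proof.
move/psumr_eq0P => x0; apply: big1 => k _; rewrite big1 ?expr0n// => j _.
have /eqP := x0 (fun j _ => sqr_ge0 _) j isT.
by rewrite sqrf_eq0 => /eqP ->; rewrite mul0r.
Qed.

(** Normalised by the sum of the [x j ^+ 2], [rowsq] is chi-square with [#|K|] degrees of freedom;
    this is its Laplace transform in the parametrisation of [integral_normal_exp_sqr]. *)
Lemma integral_exp_rowsq s : 0 < s -> 0 < \sum_j x j ^+ 2 ->
  (\int[mu]_t (expR ((1 - s ^- 2) / 2 / (\sum_j x j ^+ 2) * rowsq t))%:E
   = (s ^+ #|K|)%:E)%E.
Proof.
move=> s0; set q := \sum_j _ => q0; set l := (1 - _) / 2.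
pose psi u := expR (l / q * u ^+ 2).
have mpsi : measurable_fun setT psi.
  rewrite /psi; apply: measurableT_comp => //; exact: measurable_funM.
have psiE : (\int[normal_prob 0 1]_u (psi (Num.sqrt q * u))%:E = s%:E)%E.
  rewrite -(integral_normal_exp_sqr s0); apply: eq_integral => u _.
  rewrite /psi exprMn sqr_sqrtr ?ltW// -/l; congr (expR _)%:E.
  by field; rewrite gt_eqF.
have psi0 u : 0 <= psi u by exact: expR_ge0.
have := std_gaussian_rows Hmu idx_inj mpsi psi0 psiE (enum_uniq K).
rewrite -cardE => <-; apply: eq_integral => t _; congr EFin.
by rewrite big_enum -expR_sum -mulr_sumr.
Qed.

Lemma rowsq_lower_tail :
  (mu [set t | (rowsq t < 5 / 8 * #|K|%:R * \sum_j x j ^+ 2)%R]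
   <= (expR (- (#|K|%:R / 64)))%:E)%E.
Proof.
have [q0|q0] := eqVneq (\sum_j x j ^+ 2) 0.
  rewrite (_ : [set _ | _] = set0) ?measure0 ?lee_fin ?expR_ge0//.
  by apply/seteqP; split => t //=; rewrite rowsq_eq0// q0 mulr0 ltxx.
have {}q0 : 0 < \sum_j x j ^+ 2.
  by rewrite lt_neqAle eq_sym q0 sumr_ge0// => j _; exact: sqr_ge0.
(* [E exp (- 9/32 u^2) = 4/5], and [4/5 * exp (5/8 * 9/32) <= exp (- 1/64)]. *)
have s0 : 0 < 4 / 5 :> R by lra.
have IE := integral_exp_rowsq s0 q0.
set q := \sum_j _ in q0 IE *.
have mZ : measurable_fun setT
    (fun t => (1 - (4 / 5) ^- 2) / 2 / q * rowsq t : R).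
  by apply: measurable_funM => //; exact: measurable_rowsq.
have := markov_exp (mu := mu) (- (45 / 256 * #|K|%:R)) mZ (c := (4 / 5) ^+ #|K|).
rewrite IE => /(_ (lexx _)); rewrite opprK => mk; apply: le_trans (le_trans mk _).
  apply: le_measure; rewrite ?inE.
  - exact: measurable_strict_sublevel measurable_rowsq.
  - exact: measurable_superlevel mZ.
  - move=> t /= lt; rewrite (_ : _ * rowsq t = - (9 / 32 / q * rowsq t)).
      rewrite lerN2 mulrAC ler_pdivrMr//; lra.
    by field; rewrite gt_eqF.
have -> : (4 / 5) ^+ #|K| * expR (45 / 256 * #|K|%:R)
    = (4 / 5 * expR (45 / 256)) ^+ #|K| :> R.
  by rewrite [RHS]exprMn -expRM_natl; congr (_ * expR _); rewrite mulrC.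
have -> : expR (- (#|K|%:R / 64)) = expR (- 64^-1) ^+ #|K| :> R.
  by rewrite -expRM_natl mulrN.
(* Since [45/256 = 49/256 - 1/64], it remains to see [expR (49/256) <= 5/4]; the inverse is at least
   [1 - 49/256 = 207/256], which exceeds [4/5]. *)
have X0 := expR_ge0 (49 / 256 : R).
have X1 : expR (49 / 256) * expR (- (49 / 256)) = 1 :> R by rewrite -expRD subrr expR0.
have Y1 := expR_ge1Dx (- (49 / 256) : R).
have XE : expR (45 / 256) = expR (- 64^-1) * expR (49 / 256) :> R.
  by rewrite -expRD; congr expR; field.
have P0 : 0 <= 4 / 5 * expR (45 / 256) :> R.
  by apply: mulr_ge0; [lra|exact: expR_ge0].
rewrite lee_fin; apply: lerXn2r; rewrite ?nnegrE; [exact: P0|exact: expR_ge0|].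
rewrite XE mulrCA; apply: ler_piMr; [exact: expR_ge0|nra].
Qed.

Lemma rowsq_upper_tail :
  (mu [set t | (2 * #|K|%:R * \sum_j x j ^+ 2 < rowsq t)%R]
   <= (expR (- (#|K|%:R / 64)))%:E)%E.
Proof.
have [q0|q0] := eqVneq (\sum_j x j ^+ 2) 0.
  rewrite (_ : [set _ | _] = set0) ?measure0 ?lee_fin ?expR_ge0//.
  by apply/seteqP; split => t //=; rewrite rowsq_eq0// q0 mulr0 ltxx.
have {}q0 : 0 < \sum_j x j ^+ 2.
  by rewrite lt_neqAle eq_sym q0 sumr_ge0// => j _; exact: sqr_ge0.
(* [E exp (u^2 / 4) = sqrt 2], and [sqrt 2 * exp (- 1/2) <= exp (- 1/64)]. *)
have s0 : 0 < Num.sqrt 2 :> R by rewrite sqrtr_gt0; lra.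
have s2 : Num.sqrt 2 ^+ 2 = 2 :> R by rewrite sqr_sqrtr; lra.
have IE := integral_exp_rowsq s0 q0.
set q := \sum_j _ in q0 IE *.
have mZ : measurable_fun setT
    (fun t => (1 - (Num.sqrt 2) ^- 2) / 2 / q * rowsq t : R).
  by apply: measurable_funM => //; exact: measurable_rowsq.
have := markov_exp (mu := mu) (2^-1 * #|K|%:R) mZ (c := Num.sqrt 2 ^+ #|K|).
rewrite IE => /(_ (lexx _)) mk.
apply: le_trans (le_trans mk _).
  apply: le_measure; rewrite ?inE.
  - exact: measurable_strict_superlevel measurable_rowsq.
  - exact: measurable_superlevel mZ.
  - move=> t /= lt; rewrite s2 mulrAC ler_pdivlMr//; lra.
have -> : Num.sqrt 2 ^+ #|K| * expR (- (2^-1 * #|K|%:R))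
    = (Num.sqrt 2 * expR (- 2^-1)) ^+ #|K| :> R.
  by rewrite [RHS]exprMn -expRM_natl; congr (_ * expR _); rewrite mulrN mulrC.
have -> : expR (- (#|K|%:R / 64)) = expR (- 64^-1) ^+ #|K| :> R.
  by rewrite -expRM_natl mulrN.
have P0 : 0 <= Num.sqrt 2 * expR (- 2^-1) :> R.
  by apply: mulr_ge0; [exact: ltW|exact: expR_ge0].
rewrite lee_fin; apply: lerXn2r; rewrite ?nnegrE; [exact: P0|exact: expR_ge0|].
(* What remains is [sqrt 2 <= expR (31/64)], true because [1 + 31/64] already exceeds [sqrt 2]. *)
have -> : expR (- 64^-1) = expR (31 / 64) * expR (- 2^-1) :> R.
  by rewrite -expRD; congr expR; field.
rewrite ler_wpM2r ?expR_ge0//.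
have := expR_ge1Dx (31 / 64 : R); move: s0 s2.
nra.
Qed.

End ChiSquare.

(** Chernoff's bound for each sign [b], with the optimal parameter [r / B] absorbed into the
    weights. The bound [B] on their squared norm is deterministic, so it passes through the outer
    integral. *)
Lemma conditional_gaussian_tail (K : finType) (e : K -> I) (w : K -> T -> R)
    (B r : R) : injective e -> (forall k, measurable_fun setT (w k)) ->
  (forall k l y t, w k (upd (e l) y t) = w k t) ->
  (forall t, \sum_k w k t ^+ 2 <= B) -> 0 < B -> 0 < r ->
  (mu [set t | (r < `|\sum_k w k t * entry (e k) t|)%R]
   <= (2 * expR (- (r ^+ 2 / (2 * B))))%:E)%E.
Proof.
move=> e_inj mw we wB B0 r0.
have one (b : bool) : (mu [set t | (r ^+ 2 / B
    <= \sum_k ((-1) ^+ b * (r / B) * w k t) * entry (e k) t)%R]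
    <= (expR (- (r ^+ 2 / (2 * B))))%:E)%E.
  have mW k : measurable_fun setT (fun t => (-1) ^+ b * (r / B) * w k t).
    exact: measurable_funM.
  have -> : expR (- (r ^+ 2 / (2 * B))) =
      expR (r ^+ 2 / (2 * B)) * expR (- (r ^+ 2 / B)).
    by rewrite -expRD; congr expR; field; rewrite gt_eqF.
  apply: markov_exp.
    by apply: measurable_sum => k; apply: measurable_funM => //; exact: measurable_entry.
  have := @std_gaussian_conditional_exp _ _ _ Hmu _ e
    (fun k t => (-1) ^+ b * (r / B) * w k t) (enum K) (fun=> 1) e_inj mW.
  move=> /(_ _ _ _ _ (enum_uniq K)) E.
  have {}E := E (fun k l y t => congr1 _ (we k l y t))
    (measurable_cst _) (fun=> ler01) (fun _ _ _ => erefl).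
  under eq_integral => t _ do rewrite -[expR _]mul1r -big_enum.
  rewrite E; apply: (@le_trans _ _ (\int[mu]_t (expR (r ^+ 2 / (2 * B)))%:E)%E); last first.
    by rewrite integral_cst//= probability_setT mule1.
  apply: (ge0_le_integral mu measurableT).
  - by move=> t _; rewrite lee_fin mul1r expR_ge0.
  - apply/measurable_EFinP; apply: measurable_funM => //.
    apply: measurableT_comp => //; apply: measurable_sum => k.
    by apply: measurable_funM => //; exact: measurable_funX.
  - exact: measurable_cst.
  - move=> t _; rewrite lee_fin mul1r ler_expR big_enum/=.
    under eq_bigr do rewrite exprMn exprMn sqrr_sign mul1r -mulrA.
    rewrite -mulr_sumr -mulr_suml; apply: (@le_trans _ _ ((r / B) ^+ 2 * (B / 2))).
      by rewrite ler_wpM2l ?sqr_ge0// ler_wpM2r.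
    by rewrite le_eqVlt; apply/orP; left; apply/eqP; field; rewrite gt_eqF.
have mS b : measurable [set t | r ^+ 2 / B
    <= \sum_k ((-1) ^+ b * (r / B) * w k t) * entry (e k) t].
  apply: measurable_superlevel; apply: measurable_sum => // k.
  by apply: measurable_funM; [exact: measurable_funM|exact: measurable_entry].
have mL : measurable_fun setT (fun t => \sum_k w k t * entry (e k) t).
  by apply: measurable_sum => k; apply: measurable_funM => //; exact: measurable_entry.
apply: le_trans (_ : (mu ([set t | (r ^+ 2 / B
    <= \sum_k ((-1) ^+ false * (r / B) * w k t) * entry (e k) t)%R]
  `|` [set t | (r ^+ 2 / B
    <= \sum_k ((-1) ^+ true * (r / B) * w k t) * entry (e k) t)%R]) <= _)%E).
  apply: le_measure; rewrite ?inE; last 2 first.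
  - exact: measurableU.
  - move=> t /=; set S := \sum_k _ => rS.
    have E b : \sum_k ((-1) ^+ b * (r / B) * w k t) * entry (e k) t
        = (-1) ^+ b * (r / B) * S.
      by rewrite mulr_sumr; apply: eq_bigr => k _; rewrite -!mulrA.
    have rB0 : 0 <= r / B by rewrite divr_ge0// ltW.
    rewrite !E expr0 expr1 !mul1r; case: (ltrP 0 S) rS => [S0|S0].
      rewrite gtr0_norm// => rS; left.
      by rewrite expr2 mulrAC ler_wpM2l// ltW.
    rewrite ler0_norm// => rS; right.
    by rewrite mulN1r mulNr -mulrN expr2 mulrAC ler_wpM2l// ltW.
  by apply: measurable_strict_superlevel; exact: measurableT_comp.
apply: le_trans (measureU2 _ _ _) _ => //.
apply: le_trans (leeD (one false) (one true)) _.
rewrite -EFinD lee_fin; lra.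
Qed.

End Tails.

(** * The test on a well-behaved design *)

Section Finsets.

Lemma card_mkset (T : finType) (b : pred T) :
  #|[set x : T | b x]| = #|finset b|.
Proof. by apply: eq_card => x; rewrite inE; apply/idP/idP; rewrite inE. Qed.

Lemma exists_subset_card (T : finType) (A : {set T}) n :
  (n <= #|A|)%N -> exists2 B : {set T}, B \subset A & #|B| = n.
Proof.
move=> nA; exists (finset (mem (take n (enum A)))).
  by apply/fintype.subsetP => x; rewrite inE => /mem_take; rewrite mem_enum.
rewrite cardsE (card_uniqP (take_uniq _ (enum_uniq _))) size_takel//.
by rewrite -cardE.
Qed.

End Finsets.

Section Restriction.
Context {R : realType} {p : nat}.
Implicit Types (u v : 'cV[R]_p) (S : {set 'I_p}).

Lemma restrE S u i : restr S u i 0 = if i \in S then u i 0 else 0.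
Proof. by rewrite mxE. Qed.

Lemma restr_setC S u : restr S u + restr (~: S) u = u.
Proof.
by apply/matrixP => i j; rewrite !mxE ord1 finset.in_setC; case: ifP; rewrite ?addr0 ?add0r.
Qed.

Lemma sqnorm_restr S u : sqnorm (restr S u) = \sum_(i in S) u i 0 ^+ 2.
Proof.
rewrite [RHS]big_mkcond; apply: eq_bigr => i _; rewrite restrE.
by case: ifP; rewrite ?expr0n.
Qed.

Lemma dot_supported S u v : (forall i, i \notin S -> u i 0 = 0) ->
  (forall i, i \in S -> v i 0 = 0) -> dot u v = 0.
Proof.
move=> uS vS; apply: big1 => i _.
by have [iS|iS] := boolP (i \in S); [rewrite vS// mulr0|rewrite uS// mul0r].
Qed.

Lemma d2_sqr_le (A : set 'cV[R]_p) u v : A v -> d2 u A ^+ 2 <= sqnorm (u - v).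
Proof.
move=> Av; have lb0 : lbound [set Num.sqrt (sqnorm (u - v)) | v in A] 0.
  by move=> _ [w _ <-]; exact: sqrtr_ge0.
have d0 : 0 <= d2 u A by apply: lb_le_inf => //; exists (Num.sqrt (sqnorm (u - v))), v.
rewrite -[leRHS]sqr_sqrtr ?sqnorm_ge0// lerXn2r ?nnegrE ?sqrtr_ge0//.
by apply: ge_inf; [exists 0|exists v].
Qed.

Lemma l0normE u : l0norm u = #|[set i | u i 0 != 0]%SET|.
Proof. by rewrite /l0norm card_mkset. Qed.

(** Zeroing the coordinates in [B] leaves a [k]-sparse competitor for the infimum. *)
Lemma d2_B0_sqr_le k u (B : {set 'I_p}) : B \subset [set i | u i 0 != 0]%SET ->
  (l0norm u <= k + #|B|)%N -> d2 u (B0 k) ^+ 2 <= \sum_(i in B) u i 0 ^+ 2.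
Proof.
move=> Bu; rewrite l0normE => uB.
have BE : restr B u = u - restr (~: B) u.
  by apply/eqP; rewrite eq_sym subr_eq restr_setC.
rewrite -sqnorm_restr BE; apply: d2_sqr_le.
rewrite /B0/= l0normE.
have -> : [set i | restr (~: B) u i 0 != 0]%SET = [set i | u i 0 != 0]%SET :\: B.
  apply/setP => i; rewrite !inE restrE finset.in_setC.
  by case: (i \in B); rewrite ?eqxx ?andbF ?andbT.
by rewrite cardsD (finset.setIidPr Bu) leq_subLR addnC.
Qed.

End Restriction.

Section LeastSquares.
Context {R : realType} (m p : nat).
Variables (X : 'M[R]_(m, p)) (S : {set 'I_p}).
Variable est : 'M[R]_(m, p) -> 'cV[R]_m -> 'cV[R]_p.
Hypothesis est_ls : ls_selection S est.

(** Moving the minimiser along a coordinate of [S] keeps it admissible, so the linear term of the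
    objective vanishes by [quad_ge0_lin0]. *)
Lemma normal_equations Y i : i \in S -> (X^T *m (Y - X *m est X Y)) i 0 = 0.
Proof.
move=> iS; have [supp min] := est_ls X Y.
rewrite -dot_delta dot_mulmx trmxK; set r := Y - _.
apply: (@quad_ge0_lin0 _ _ (sqnorm (X *m delta_mx i 0))) => e.
have := min (est X Y - e *: delta_mx i 0).
rewrite mulmxBr opprB addrCA -/r -scalemxAr addrC; clearbody r.
rewrite sqnormD dotZr sqnormZ -addrA lerDl mulrA; apply => j jS.
rewrite !mxE supp// eqxx andbT; case: eqP => [ji|_]; first by rewrite ji iS in jS.
by rewrite mulr0 subr0.
Qed.

End LeastSquares.

(** * Deterministic level and power on the good event *)

Section GoodDesign.
Context {R : realType} (m p : nat).
Variables (X : 'M[R]_(m, p)) (eps : 'cV[R]_m) (theta nu : 'cV[R]_p).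
Variables (S : {set 'I_p}) (sigma eta a1 a2 a3 L cstar : R) (k0 : nat).
Variable est : 'M[R]_(m, p) -> 'cV[R]_m -> 'cV[R]_p.

Local Notation M := (m%:R : R).
Local Notation rt := (rate p m : R).
Local Notation tail := (restr (~: S) theta).
Let Y : 'cV[R]_m := X *m theta + sigma *: eps.
Let that := est X Y.
Let shat := sigma_hat est X Y.

Hypotheses (m0 : (0 < m)%N) (p3 : (3 <= p)%N) (sigma0 : 0 < sigma) (eta1 : 1 < eta).
Hypotheses (a10 : 0 < a1) (a30 : 0 < a3) (L1 : 1 <= L).
Hypothesis thetaS : propS m theta sigma a1 a2 a3 S.
Hypothesis cstar_ge : Num.sqrt 2 * a1 + 11 * eta ^+ 2 * Num.max a3 1 * L <= cstar.
Hypothesis est_ls : ls_selection S est.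
Hypothesis design_lower : forall v : 'cV[R]_p, (forall i, i \notin S -> v i 0 = 0) ->
  M / 2 * (eta^-1 * sqnorm v) <= sqnorm (X *m v).
Hypothesis resid_lower : forall v : 'cV[R]_p, (forall i, i \notin S -> v i 0 = 0) ->
  M / 2 * sigma ^+ 2 <= sqnorm (X *m (v + tail) + sigma *: eps).
Hypothesis bias_upper : sqnorm (X *m tail) <= 2 * M * (eta * sqnorm tail).
Hypothesis resid_upper : sqnorm (X *m tail + sigma *: eps)
  <= 2 * M * (eta * sqnorm tail + sigma ^+ 2).
Hypothesis nuS : forall i, i \notin S -> nu i 0 = 0.
Hypothesis nu_ls : forall i, i \in S -> (X^T *m (eps - X *m nu)) i 0 = 0.
Hypothesis nu_le : forall i, `|nu i 0| <= 2 * eta * L * rt.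

Let M0 : 0 < M. Proof. by rewrite ltr0n. Qed.

Let lnp0 : 0 < ln (p%:R : R).
Proof. by rewrite ln_gt0// ltr1n (leq_trans _ p3). Qed.

Let rt0 : 0 < rt. Proof. by rewrite sqrtr_gt0 divr_gt0. Qed.

Let rt2 : rt ^+ 2 = ln (p%:R) / M.
Proof. by rewrite sqr_sqrtr// divr_ge0// ltW. Qed.

Let eta0 : 0 < eta. Proof. exact: lt_trans ltr01 eta1. Qed.

Let m3a : a3 <= Num.max a3 1. Proof. by rewrite le_max lexx. Qed.
Let m31 : 1 <= Num.max a3 1. Proof. by rewrite le_max lexx orbT. Qed.

Let L0 : 0 <= L. Proof. exact: le_trans ler01 L1. Qed.
Let eL0 : 0 <= eta * L. Proof. by rewrite mulr_ge0// ltW. Qed.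
Let ea30 : 0 <= eta * a3. Proof. by rewrite mulr_ge0// ltW. Qed.

Let s20 : 0 <= Num.sqrt 2 :> R. Proof. exact: sqrtr_ge0. Qed.
Let s22 : Num.sqrt 2 ^+ 2 = 2 :> R. Proof. by rewrite sqr_sqrtr. Qed.

Let eta2 : 1 <= eta ^+ 2. Proof. by rewrite expr_ge1// ltW. Qed.

(* Since [11 >= 7 * sqrt 2], the constant 11 leaves room for the noise
   ([2 * eta * L]) and for the bias ([5 * eta * a3]). *)
Let cstar_split : Num.sqrt 2 * (a1 + 2 * eta * L + 5 * eta * a3) <= cstar.
Proof.
apply: le_trans cstar_ge; rewrite mulrDr mulrDr -addrA lerD2l -mulrDr.
have s2 : Num.sqrt 2 <= 11 / 7 :> R.
  by rewrite leNgt; apply/negP => h; have := s22; nra.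
have ee : eta <= eta ^+ 2 by rewrite expr2 ler_peMr// ltW.
move: m3a m31; set m3 := Num.max a3 1 => m3a' m31'.
have A1 : eta * L <= eta ^+ 2 * m3 * L.
  by rewrite ler_wpM2r// (le_trans ee)// ler_peMr// sqr_ge0.
have A2 : eta * a3 <= eta ^+ 2 * m3 * L.
  apply: (@le_trans _ _ (eta ^+ 2 * m3)).
    by apply: ler_pM => //; apply: ltW.
  by rewrite ler_peMr// mulr_ge0 ?sqr_ge0//; lra.
have B0 := eL0; have B1 := ea30.
apply: (@le_trans _ _ (11 / 7 * (2 * eta * L + 5 * eta * a3))); last lra.
by rewrite ler_wpM2r//; lra.
Qed.

Let c0 : 0 < cstar.
Proof.
apply: lt_le_trans cstar_split; apply: mulr_gt0; first by rewrite sqrtr_gt0.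
by have := eL0; have := ea30; have := a10; lra.
Qed.

Let ca1 : 2 * a1 ^+ 2 <= cstar ^+ 2.
Proof.
have -> : 2 * a1 ^+ 2 = (Num.sqrt 2 * a1) ^+ 2 by rewrite exprMn s22.
have s2a : Num.sqrt 2 * a1 <= cstar.
  apply: le_trans cstar_split; rewrite ler_wpM2l//.
  by have := eL0; have := ea30; lra.
by apply: lerXn2r => //; rewrite nnegrE ?mulr_ge0// ltW.
Qed.

Let sqrt2_ge1 : 1 <= Num.sqrt 2 :> R.
Proof. by rewrite -[leLHS]sqrtr1 ler_sqrt; lra. Qed.

Let ca_sum : a1 + 2 * eta * L + 5 * eta * a3 <= cstar.
Proof.
apply: le_trans cstar_split; rewrite ler_peMl//.
by have := eL0; have := ea30; have := a10; lra.
Qed.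

Let ca3 : a3 <= cstar.
Proof.
have ae : a3 <= eta * a3 by rewrite ler_peMl// ltW.
by apply: le_trans ca_sum; have := eL0; have := ea30; have := a10; lra.
Qed.

Let Ms := [set i | (0 < `|(sigma^-1 *: theta) i 0|) &&
  (`|(sigma^-1 *: theta) i 0| <= a1 * rt)]%SET.
Let supp := [set i | theta i 0 != 0]%SET.

Let McountE : Mcount m a1 (sigma^-1 *: theta) = #|Ms|.
Proof. by rewrite /Mcount card_mkset. Qed.

Let Ms_supp : Ms \subset supp.
Proof.
apply/fintype.subsetP => i; rewrite !inE mxE normr_gt0 mulf_eq0 negb_or.
by case/andP => /andP[].
Qed.

Let Ms_le i : i \in Ms -> `|theta i 0| <= a1 * sigma * rt.
Proof.
rewrite inE mxE normrM gtr0_norm ?invr_gt0// => /andP[_].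
by rewrite ler_pdivrMl// => /le_trans; apply; rewrite mulrCA mulrA.
Qed.

Let small_le i : i \notin supp :\: Ms -> `|theta i 0| <= a1 * sigma * rt.
Proof.
rewrite finset.in_setD negb_and negbK => /orP[|]; first exact: Ms_le.
rewrite inE negbK => /eqP ->; rewrite normr0 !mulr_ge0 ?ltW//.
Qed.

Let tail_le : sqnorm tail <= a3 ^+ 2 * sigma ^+ 2 * rt ^+ 2 * #|Ms|%:R.
Proof.
have [_] := thetaS; rewrite McountE => /le_trans; apply.
by rewrite rt2 le_eqVlt; apply/orP; left; apply/eqP; field; rewrite gt_eqF.
Qed.

Let thatS i : i \notin S -> that i 0 = 0.
Proof. by have [+ _] := est_ls X Y; apply. Qed.

(** The estimation error not due to noise; [X *m bias] is the projection of [X *m tail] onto the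
    columns in [S]. *)
Let bias := that - restr S theta - sigma *: nu.

Let biasS i : i \notin S -> bias i 0 = 0.
Proof.
by move=> iS; rewrite !mxE thatS// (negPf iS) nuS// mulr0 !subr0.
Qed.

(** Subtracting the normal equations of [that] and [nu] shows that [X *m tail - X *m bias] is
    orthogonal to the columns in [S], so [X *m bias] is no longer than [X *m tail]. The factor comes
    from dividing [2 * M * eta] by [M / (2 * eta)]. *)
Let bias_le : sqnorm bias <= 4 * eta ^+ 2 * sqnorm tail.
Proof.
have residE : X *m tail - X *m bias = (Y - X *m that) - sigma *: (eps - X *m nu).
  rewrite /Y /bias -[in RHS](restr_setC S theta) !(mulmxDr, mulmxN) -!scalemxAr.

  move: (X *m that) (X *m restr S theta) (X *m tail) (X *m nu) => x1 x2 x3 x4.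
  by apply/matrixP => i j; rewrite !mxE; ring.
have orth : dot (X *m bias) (X *m tail - X *m bias) = 0.
  rewrite dot_mulmx; apply: dot_supported biasS _ => i iS.
  rewrite residE mulmxBr -scalemxAr.
  have := nu_ls iS; have := normal_equations X est_ls Y iS; rewrite -/that.
  move: (X^T *m (Y - X *m that)) (X^T *m (eps - X *m nu)) => z1 z2 z10 z20.
  by rewrite !mxE z10 z20 mulr0 subrr.
have : sqnorm (X *m bias) <= sqnorm (X *m tail).
  have -> : X *m tail = X *m bias + (X *m tail - X *m bias) by rewrite addrC subrK.
  by rewrite sqnormD orth mulr0 addr0 lerDl sqnorm_ge0.
move=> /(le_trans (design_lower biasS)) /le_trans /(_ bias_upper).
rewrite -ler_pdivlMl ?divr_gt0// => {}H.
rewrite -(@ler_pM2l _ eta^-1) ?invr_gt0//; apply: le_trans H _.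
by rewrite le_eqVlt; apply/orP; left; apply/eqP; field; rewrite !gt_eqF.
Qed.

Let shat2 : shat ^+ 2 = sqnorm (Y - X *m that) / M.
Proof. by rewrite sqr_sqrtr// divr_ge0 ?sqnorm_ge0// ltW. Qed.

(** The residual has the form covered by [resid_lower], with [v = restr S theta - that]; that bound
    is uniform in [v], so its dependence on the data is harmless. *)
Let shat_lower : sigma ^+ 2 <= 2 * shat ^+ 2.
Proof.
have vS i : i \notin S -> (restr S theta - that) i 0 = 0.
  by move=> iS; rewrite !mxE (negPf iS) thatS// subrr.
have := resid_lower vS.
have -> : X *m (restr S theta - that + tail) + sigma *: eps = Y - X *m that.
  by rewrite addrAC restr_setC mulmxBr /Y addrAC.
rewrite shat2 => H; rewrite mulrA ler_pdivlMr//; lra.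
Qed.

Let shat_upper : shat ^+ 2 <= 2 * (eta * sqnorm tail + sigma ^+ 2).
Proof.
have [_ /(_ (restr S theta))] := est_ls X Y.
have -> : Y - X *m restr S theta = X *m tail + sigma *: eps.
  rewrite /Y -[X in _ *m X + _](restr_setC S theta) mulmxDr.
  move: (X *m restr S theta) (X *m tail) => x1 x2.
  by apply/matrixP => i j; rewrite !mxE; ring.
move=> H; rewrite shat2 ler_pdivrMr//.
apply: le_trans (le_trans (H _) resid_upper) _; last by lra.
by move=> i iS; rewrite mxE (negPf iS).
Qed.

Let shat0 : 0 < shat.
Proof.
rewrite lt_neqAle sqrtr_ge0 andbT eq_sym; apply/eqP => s0.
by have := shat_lower; rewrite s0 expr0n mulr0; apply/negP; rewrite -ltNge exprn_gt0.
Qed.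

Let shat_ge : sigma <= Num.sqrt 2 * shat.
Proof.
have W0 : 0 <= Num.sqrt 2 * shat by rewrite mulr_ge0// ltW.
have W2 : (Num.sqrt 2 * shat) ^+ 2 = 2 * shat ^+ 2 by rewrite exprMn s22.
rewrite leNgt; apply/negP => h; have := shat_lower; have := sigma0; rewrite -W2.
by move: W0 h; set W := _ * shat; nra.
Qed.

Let Det := [set i | cstar * shat * rt <= `|that i 0|]%SET.

Let NcountE : Ncount m cstar (shat^-1 *: that) = #|Det|.
Proof.
rewrite /Ncount card_mkset; apply: eq_card => i; rewrite !inE mxE.
by rewrite normrM gtr0_norm ?invr_gt0// ler_pdivlMl// mulrCA mulrA.
Qed.

Let that_le i : `|that i 0| <= `|theta i 0| + `|bias i 0| + sigma * (2 * eta * L * rt).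
Proof.
have [iS|iS] := boolP (i \in S); last first.
  rewrite thatS// normr0 -!mulrA; apply: addr_ge0; first exact: addr_ge0.
  by rewrite !mulr_ge0// ltW.
have -> : that i 0 = theta i 0 + bias i 0 + sigma * nu i 0.
  by rewrite !mxE iS; ring.
apply: le_trans (ler_normD _ _) (lerD (ler_normD _ _) _).
by rewrite normrM gtr0_norm// ler_wpM2l// ltW.
Qed.

(** A detection outside [supp :\: Ms] exceeds a small coefficient plus the noise by
    [5 * eta * a3 * sigma * rt], and only [bias] can supply that. Comparing squares with [bias_le]
    and [tail_le] gives at most [4/25] of [#|Ms|] such detections. *)
Let false_detections : (#|Det :\: (supp :\: Ms)| <= #|Ms|)%N.
Proof.
set F := Det :\: _.
have big i : i \in F -> 25 * eta ^+ 2 * (a3 ^+ 2 * sigma ^+ 2 * rt ^+ 2) <= bias i 0 ^+ 2.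
  rewrite finset.in_setD => /andP[/small_le th]; rewrite inE => det.
  have B0 : 0 <= 5 * eta * a3 * sigma * rt by rewrite !mulr_ge0// ltW.
  have : 5 * eta * a3 * sigma * rt <= `|bias i 0|.
    have : (a1 + 2 * eta * L + 5 * eta * a3) * sigma * rt <= `|that i 0|.
      apply: le_trans det; apply: ler_wpM2r; first exact: ltW.
      apply: (@le_trans _ _ ((a1 + 2 * eta * L + 5 * eta * a3) * (Num.sqrt 2 * shat))).
        rewrite -!mulrA ler_wpM2l//.
        by have := eL0; have := ea30; have := a10; lra.
      rewrite mulrA; apply: ler_wpM2r; first exact: ltW.
      by rewrite mulrC; exact: cstar_split.
    have := that_le i; lra.
  rewrite -(@ler_pXn2r _ 2) ?nnegrE// real_normK ?num_real// => /(le_trans _); apply.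
  by rewrite le_eqVlt; apply/orP; left; apply/eqP; ring.
have Q0 : 0 < a3 ^+ 2 * sigma ^+ 2 * rt ^+ 2 by rewrite !mulr_gt0 ?exprn_gt0.
have : #|F|%:R * (25 * eta ^+ 2 * (a3 ^+ 2 * sigma ^+ 2 * rt ^+ 2)) <= sqnorm bias.
  rewrite mulr_natl -sumr_const; apply: (@le_trans _ _ (\sum_(i in F) bias i 0 ^+ 2)).
    exact: ler_sum.
  rewrite /sqnorm [leRHS](bigID (mem F))/= lerDl sumr_ge0// => i _; exact: sqr_ge0.
move=> /le_trans /(_ bias_le) H; rewrite -(ler_nat R).
rewrite -(@ler_pM2r _ (25 * eta ^+ 2 * (a3 ^+ 2 * sigma ^+ 2 * rt ^+ 2))); last first.
  by rewrite !mulr_gt0 ?exprn_gt0//; lra.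
apply: (le_trans H); move: Q0 tail_le; set Q := a3 ^+ 2 * _ * _ => Q0 tailQ.
apply: (@le_trans _ _ (4 * eta ^+ 2 * (Q * #|Ms|%:R))).
  by rewrite ler_wpM2l// mulr_ge0 ?sqr_ge0//; lra.
have : 0 <= eta ^+ 2 * (Q * #|Ms|%:R) by rewrite !mulr_ge0 ?sqr_ge0// ltW.
lra.
Qed.

(** Detections number at most [#|supp :\: Ms| + #|Ms| = #|supp|]: the unreliable ones are paid for
    by the small coordinates. *)
Lemma good_design_level : (l0norm theta <= k0)%N -> ~~ phi_th k0 est cstar X Y.
Proof.
move=> qk; rewrite /phi_th -/that -/shat NcountE -leqNgt (leq_trans _ qk)// l0normE -/supp.
rewrite -(cardsID (supp :\: Ms) Det).
apply: leq_trans (leq_add (subset_leq_card (subsetIr _ _)) false_detections) _.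
by rewrite cardsD (finset.setIidPr Ms_supp) subnK// subset_leq_card.
Qed.

(** If the test accepted, at least [D] support coordinates would be undetected. Zeroing [D] of them
    is admissible for [d2], and their squared mass is too small for the separation. *)
Lemma good_design_power : (k0 < l0norm theta)%N ->
  23 * eta ^+ 2 * (1 + a3 ^+ 2 * (l0norm theta)%:R * rt ^+ 2) * cstar ^+ 2
    * sigma ^+ 2 * (((l0norm theta)%:R - k0%:R) * rt ^+ 2)
  <= d2 theta (B0 k0) ^+ 2 ->
  phi_th k0 est cstar X Y.
Proof.
rewrite /phi_th -/that -/shat NcountE l0normE -/supp => kq.
set kap := 1 + _; have -> : #|supp|%:R - k0%:R = (#|supp| - k0)%:R :> R.
  by rewrite natrB// ltnW.
set D := (#|supp| - k0)%N => dlow.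
have D0 : 0 < D%:R :> R by rewrite ltr0n subn_gt0.
have kap1 : 1 <= kap by rewrite lerDl; exact: mulr_ge0 (mulr_ge0 (sqr_ge0 _) (ler0n _ _)) (sqr_ge0 _).
have Q0 : 0 < cstar ^+ 2 * sigma ^+ 2 * (D%:R * rt ^+ 2).
  by rewrite !mulr_gt0 ?exprn_gt0.
have low : 23 * eta ^+ 2 * kap * (cstar ^+ 2 * sigma ^+ 2 * (D%:R * rt ^+ 2))
    <= d2 theta (B0 k0) ^+ 2 by apply: le_trans dlow; rewrite !mulrA.
have upp (B : {set 'I_p}) : B \subset supp -> #|B| = D ->
    d2 theta (B0 k0) ^+ 2 <= \sum_(i in B) theta i 0 ^+ 2.
  by move=> Bs BD; apply: d2_B0_sqr_le => //; rewrite l0normE -/supp BD subnKC// ltnW.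
have low1 : 23 * (cstar ^+ 2 * sigma ^+ 2 * (D%:R * rt ^+ 2)) <= d2 theta (B0 k0) ^+ 2.
  apply: le_trans low; apply: ler_wpM2r; first exact: ltW.
  have : 1 <= eta ^+ 2 * kap by rewrite mulr_ege1.
  lra.
(* Otherwise [D] coordinates of [Ms] bound the squared distance by [D * (a1 * sigma * rt) ^ 2],
   which contradicts [low1] as [2 * a1 ^ 2 <= cstar ^ 2]. *)
have MsD : (#|Ms| < D)%N.
  rewrite ltnNge; apply/negP => DM.
  have [B BM BD] := exists_subset_card DM.
  have := upp B (fintype.subset_trans BM Ms_supp) BD.
  apply/negP; rewrite -ltNge; apply: lt_le_trans low1.
  apply: (@le_lt_trans _ _ (\sum_(i in B) (a1 * sigma * rt) ^+ 2)).
    apply: ler_sum => i iB; rewrite -[leLHS](real_normK (num_real _)).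
    have iM := fintype.subsetP BM _ iB.
    by rewrite lerXn2r ?nnegrE ?mulr_ge0 ?Ms_le// ltW.
  rewrite sumr_const BD -mulr_natl.
  have : 2 * a1 ^+ 2 * (sigma ^+ 2 * (D%:R * rt ^+ 2))
      <= cstar ^+ 2 * (sigma ^+ 2 * (D%:R * rt ^+ 2)).
    apply: ler_wpM2r => //.
    exact: mulr_ge0 (sqr_ge0 _) (mulr_ge0 (ltW D0) (sqr_ge0 _)).
  lra.
rewrite ltnNge; apply/negP => detk.
have DD : (D <= #|supp :\: Det|)%N.
  rewrite cardsD leq_sub2l// (leq_trans _ detk)// subset_leq_card//.
  exact: subsetIr.
have [B BM BD] := exists_subset_card DD.
have := upp B (fintype.subset_trans BM (subsetDl _ _)) BD.
apply/negP; rewrite -ltNge; apply: lt_le_trans low.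
have tail_leD : sqnorm tail <= cstar ^+ 2 * sigma ^+ 2 * (D%:R * rt ^+ 2).
  apply: le_trans tail_le _.
  rewrite [leRHS](_ : _ = cstar ^+ 2 * sigma ^+ 2 * rt ^+ 2 * D%:R); last by ring.
  have a3c : a3 ^+ 2 <= cstar ^+ 2 by apply: lerXn2r => //; rewrite nnegrE ltW.
  apply: ler_pM; last by rewrite ler_nat ltnW.
  - exact: mulr_ge0 (mulr_ge0 (sqr_ge0 _) (sqr_ge0 _)) (sqr_ge0 _).
  - exact: ler0n.
  - by apply: ler_wpM2r (sqr_ge0 _) _ _ _; apply: ler_wpM2r (sqr_ge0 _) _ _ a3c.
(* Here [#|Ms|] is bounded by [#|supp|], which produces the factor [kap]. *)
have shat_le : shat ^+ 2 <= 2 * eta * kap * sigma ^+ 2.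
  apply: le_trans shat_upper _; rewrite -!mulrA; apply: ler_wpM2l => //.
  apply: (@le_trans _ _ (eta * (a3 ^+ 2 * sigma ^+ 2 * rt ^+ 2 * #|supp|%:R) + eta * sigma ^+ 2)).
    apply: lerD; last by apply: ler_peMl; [exact: sqr_ge0|exact: ltW].
    apply: ler_wpM2l; [exact: ltW|apply: le_trans tail_le _].
    apply: ler_wpM2l; last by rewrite ler_nat subset_leq_card.
    exact: mulr_ge0 (mulr_ge0 (sqr_ge0 _) (sqr_ge0 _)) (sqr_ge0 _).
  by rewrite le_eqVlt; apply/orP; left; apply/eqP; rewrite /kap; ring.
(* Inside [S] the coefficient is estimate minus bias minus noise, whence the factor 3 on squares;
   outside [S] it is the coordinate of [tail]. *)
apply: (@le_lt_trans _ _ (\sum_(i in B) (3 * cstar ^+ 2 * rt ^+ 2 * (shat ^+ 2 + sigma ^+ 2))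
    + (3 * sqnorm bias + sqnorm tail))).
  apply: (@le_trans _ _ (\sum_(i in B) (3 * cstar ^+ 2 * rt ^+ 2 * (shat ^+ 2 + sigma ^+ 2)
      + (3 * bias i 0 ^+ 2 + tail i 0 ^+ 2)))).
    apply: ler_sum => i /(fintype.subsetP BM); rewrite finset.in_setD inE -ltNge => /andP[nd _].
    have [iS|iS] := boolP (i \in S); last first.
      rewrite [tail i 0]restrE finset.in_setC iS biasS// expr0n mulr0 add0r lerDr.
      apply: mulr_ge0; last exact: addr_ge0 (sqr_ge0 _) (sqr_ge0 _).
      exact: mulr_ge0 (mulr_ge0 (ler0n _ 3) (sqr_ge0 _)) (sqr_ge0 _).
    rewrite [tail i 0]restrE finset.in_setC iS/= expr0n addr0.
    have -> : theta i 0 = that i 0 + - bias i 0 + - (sigma * nu i 0) by rewrite !mxE iS; ring.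
    have d1 : that i 0 ^+ 2 <= cstar ^+ 2 * rt ^+ 2 * shat ^+ 2.
      rewrite -[leLHS](real_normK (num_real _)).
      rewrite [leRHS](_ : _ = (cstar * shat * rt) ^+ 2); last by ring.
      have csr : 0 <= cstar * shat * rt by apply/ltW; rewrite !mulr_gt0.
      by apply: lerXn2r; rewrite ?nnegrE//; exact: ltW.
    have d2' : (sigma * nu i 0) ^+ 2 <= cstar ^+ 2 * rt ^+ 2 * sigma ^+ 2.
      rewrite exprMn mulrC; apply: ler_wpM2r; first exact: sqr_ge0.
      rewrite -[leLHS](real_normK (num_real _)) -exprMn.
      have cr : 0 <= cstar * rt by apply/ltW; rewrite mulr_gt0.
      apply: lerXn2r; rewrite ?nnegrE//; apply: le_trans (nu_le i) _.
      apply: ler_wpM2r; first exact: ltW.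
      by have := ca_sum; have := ea30; have := a10; lra.
    set x := that i 0 in d1 *; set y := bias i 0; set z := sigma * nu i 0 in d2' *.
    have := sqr_ge0 (x + y); have := sqr_ge0 (x + z); have := sqr_ge0 (y - z).
    move: d1 d2'; set P1 := _ * shat ^+ 2; set P2 := _ * sigma ^+ 2 => d1 d2'.
    rewrite (_ : 3 * _ * _ * _ = 3 * P1 + 3 * P2); last by rewrite /P1 /P2; ring.
    lra.
  rewrite big_split/= lerD2l big_split/= -mulr_sumr; apply: lerD.
    apply: ler_wpM2l => //; rewrite /sqnorm.
    rewrite [leRHS](bigID (mem B))/= lerDl sumr_ge0// => i _; exact: sqr_ge0.
  rewrite /sqnorm [leRHS](bigID (mem B))/= lerDl sumr_ge0// => i _; exact: sqr_ge0.
rewrite sumr_const BD -[X in X + _ < _]mulr_natl.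
set Q := cstar ^+ 2 * sigma ^+ 2 * (D%:R * rt ^+ 2) in Q0 low1 tail_leD *.
have A1 : D%:R * (3 * cstar ^+ 2 * rt ^+ 2 * (shat ^+ 2 + sigma ^+ 2))
    <= (6 * eta * kap + 3) * Q.
  apply: (@le_trans _ _ (D%:R * (3 * cstar ^+ 2 * rt ^+ 2 *
      (2 * eta * kap * sigma ^+ 2 + sigma ^+ 2)))).
    apply: ler_wpM2l; first exact: ltW.
    apply: ler_wpM2l; last by rewrite lerD2r.
    exact: mulr_ge0 (mulr_ge0 (ler0n _ 3) (sqr_ge0 _)) (sqr_ge0 _).
  by rewrite le_eqVlt; apply/orP; left; apply/eqP; rewrite /Q; ring.
have A2 : 3 * sqnorm bias + sqnorm tail <= (12 * eta ^+ 2 + 1) * Q.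
  have : sqnorm bias <= 4 * eta ^+ 2 * Q.
    apply: le_trans bias_le _; apply: ler_wpM2l => //.
    exact: mulr_ge0 (ler0n _ 4) (sqr_ge0 _).
  lra.
(* In units of [eta ^ 2 * kap] the total is at most [6 + 3 + 12 + 1 = 22], strictly below 23. *)
apply: le_lt_trans (lerD A1 A2) _; rewrite -mulrDl ltr_pM2r//.
have ee : eta <= eta ^+ 2 by rewrite expr2 ler_peMr// ltW.
have e1 : eta * kap <= eta ^+ 2 * kap by rewrite ler_wpM2r//; lra.
have e2 : eta ^+ 2 <= eta ^+ 2 * kap by rewrite ler_peMr ?sqr_ge0.
by have := eta2; lra.
Qed.

End GoodDesign.

(** * The random design *)

Section Law.
Context {R : realType} {I : finType}.
Local Notation T := (#|I|.-tuple R).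

Definition gather (Omega : Type) (g : I -> Omega -> R) (w : Omega) : T :=
  [tuple g (enum_val k) w | k < #|I|].

Lemma entry_gather (Omega : Type) (g : I -> Omega -> R) i w :
  entry i (gather g w) = g i w.
Proof. by rewrite /entry tnth_mktuple enum_rankK. Qed.

Lemma iid_std_gaussian d (Omega : measurableType d) (P : probability Omega R)
    (g : I -> Omega -> R) : iid_std_normal P g ->
  measurable_fun setT (gather g) /\ exists2 mu : probability T R,
    std_gaussian mu & forall A, measurable A -> mu A = P (gather g @^-1` A).
Proof.
move=> [mg Pg]; have mG : measurable_fun setT (gather g).
  apply/measurable_fun_tnthP => k.
  rewrite (_ : _ \o _ = g (enum_val k)); first exact: mg.
  by apply/funext => w /=; rewrite tnth_mktuple.
split => //; pose HBG := isMeasurableFun.Build _ _ _ _ (gather g) mG.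
pose G : {mfun Omega >-> T} := HB.pack (gather g) HBG.
exists (distribution P G) => [B mB|//].
rewrite -Pg//; congr (P _); apply/seteqP; split => w /= Bw i.
  by move=> _ /=; have := Bw i; rewrite entry_gather.
by rewrite entry_gather; exact: Bw.
Qed.

End Law.

(** * Measurability of matrix-valued maps *)

Section MeasurableMatrix.
Context {R : realType} d (T : measurableType d).

Definition mxmeasurable a b (F : T -> 'M[R]_(a, b)) : Prop :=
  forall i j, measurable_fun setT (fun t => F t i j).

Lemma mxmeasurable_cst a b (M : 'M[R]_(a, b)) : mxmeasurable (fun=> M).
Proof. by move=> i j. Qed.

Lemma mxmeasurable_mul a b c (F : T -> 'M[R]_(a, b)) (G : T -> 'M[R]_(b, c)) :
  mxmeasurable F -> mxmeasurable G -> mxmeasurable (fun t => F t *m G t).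
Proof.
move=> mF mG i j; under eq_fun do rewrite mxE.
by apply: measurable_sum => k; apply: measurable_funM; [exact: mF|exact: mG].
Qed.

Lemma mxmeasurable_add a b (F G : T -> 'M[R]_(a, b)) :
  mxmeasurable F -> mxmeasurable G -> mxmeasurable (fun t => F t + G t).
Proof.
move=> mF mG i j; under eq_fun do rewrite mxE.
by apply: measurable_funD; [exact: mF|exact: mG].
Qed.

Lemma mxmeasurable_trmx a b (F : T -> 'M[R]_(a, b)) :
  mxmeasurable F -> mxmeasurable (fun t => (F t)^T).
Proof. by move=> mF i j; under eq_fun do rewrite mxE; exact: mF. Qed.

Lemma mxmeasurable_scale a b (f : T -> R) (F : T -> 'M[R]_(a, b)) :
  measurable_fun setT f -> mxmeasurable F -> mxmeasurable (fun t => f t *: F t).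
Proof.
move=> mf mF i j; under eq_fun do rewrite mxE.
by apply: measurable_funM; [exact: mf|exact: mF].
Qed.

Lemma measurable_det n (F : T -> 'M[R]_n) :
  mxmeasurable F -> measurable_fun setT (fun t => \det (F t)).
Proof.
move=> mF; apply: measurable_sum => s; apply: measurable_funM.
  exact: measurable_cst.
by apply: measurable_prod => i _; exact: mF.
Qed.

Lemma mxmeasurable_adj n (F : T -> 'M[R]_n) :
  mxmeasurable F -> mxmeasurable (fun t => \adj (F t)).
Proof.
move=> mF i j; under eq_fun do rewrite mxE.
apply: measurable_funM; first exact: measurable_cst.
apply: measurable_det => k l; under eq_fun do rewrite !mxE; exact: mF.
Qed.

(** Inversion is the composite [x * expR (- ln (x ^ 2))] of measurable maps, also at 0, where both
    sides are 0 by the convention on inverses. *)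
Lemma measurable_invr (f : T -> R) : measurable_fun setT f ->
  measurable_fun setT (fun t => (f t)^-1).
Proof.
move=> mf; have E (x : R) : x^-1 = x * expR (- ln (x ^+ 2)).
  have [->|x0] := eqVneq x 0; first by rewrite invr0 mul0r.
  rewrite expRN lnK ?posrE ?exprn_even_gt0//; field; exact: x0.
under eq_fun do rewrite E.
apply: measurable_funM => //; apply: measurableT_comp => //.
apply: measurableT_comp => //; apply: (measurableT_comp (@measurable_ln R)).
exact: measurable_funX.
Qed.

End MeasurableMatrix.

(** * Least squares as an explicit function of the design *)

Section LeastSquaresWeights.
Context {R : realType} (m p : nat) (S : {set 'I_p}).

Definition mask : 'M[R]_p := \matrix_(i, j) ((i == j) && (i \in S))%:R.

(** The Gram matrix of the columns in [S], completed by the identity on the other coordinates so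
    that it is a [p] by [p] matrix that can be invertible. *)
Definition masked_gram (X : 'M[R]_(m, p)) : 'M[R]_p :=
  mask *m X^T *m X *m mask + (1%:M - mask).

(** Written by Cramer's rule to be visibly measurable in [X]; it is the inverse whenever one
    exists. *)
Definition masked_gram_inv (X : 'M[R]_(m, p)) : 'M[R]_p :=
  (\det (masked_gram X))^-1 *: \adj (masked_gram X).

(* [dot (ls_weight X i) eps] is the i-th coordinate of the least-squares
   regression of [eps] on the columns of [X] indexed by [S]. *)
Definition ls_weight (X : 'M[R]_(m, p)) (i : 'I_p) : 'cV[R]_m :=
  X *m mask *m masked_gram_inv X *m delta_mx i 0.

Lemma mask_mul (u : 'cV[R]_p) : mask *m u = restr S u.
Proof.
apply/matrixP => i j; rewrite ord1 restrE mxE (bigD1 i)//= mxE eqxx/=.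
rewrite big1 ?addr0 => [|k /negPf ki]; last by rewrite mxE eq_sym ki mul0r.
by case: (i \in S); rewrite ?mul1r ?mul0r.
Qed.

Lemma trmx_mask : mask^T = mask.
Proof. by apply/matrixP => i j; rewrite !mxE eq_sym; case: eqP => [->|]. Qed.

Lemma mask_idem : mask *m mask = mask.
Proof.
apply/matrixP => i j; rewrite !mxE (bigD1 i)//= !mxE eqxx/=.
rewrite big1 ?addr0 => [|k /negPf ki]; last by rewrite mxE eq_sym ki mul0r.
by case: (i \in S); rewrite ?andbT ?andbF ?mul1r ?mul0r.
Qed.

Lemma restr_id (u : 'cV[R]_p) : (forall i, i \notin S -> u i 0 = 0) -> restr S u = u.
Proof.
move=> uS; apply/matrixP => i j; rewrite ord1 restrE.
by have [//|iS] := boolP (i \in S); rewrite uS.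
Qed.

Variables (X : 'M[R]_(m, p)) (b : R).
Hypotheses (b0 : 0 < b).
Hypothesis lowerX : forall v : 'cV[R]_p, (forall i, i \notin S -> v i 0 = 0) ->
  b * sqnorm v <= sqnorm (X *m v).

Let D := masked_gram X.

Let maskD (u : 'cV[R]_p) : mask *m (D *m u) = mask *m (X^T *m (X *m (mask *m u))).
Proof.
rewrite /D /masked_gram mulmxDl mulmxBl mul1mx mulmxDr mulmxBr !mulmxA.
by rewrite !mask_idem subrr addr0.
Qed.

(** [D] is the identity off [S], so a solution vanishes there when the right-hand side does. *)
Let supp_of_D (u v : 'cV[R]_p) : D *m u = v -> mask *m v = v -> mask *m u = u.
Proof.
move=> Duv mv; apply/eqP; rewrite eq_sym -subr_eq0; apply/eqP.
have := maskD u; rewrite Duv mv => E.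
have : D *m u = mask *m (X^T *m (X *m (mask *m u))) + (u - mask *m u).
  by rewrite /D /masked_gram mulmxDl mulmxBl mul1mx !mulmxA.
by rewrite Duv -E -[LHS]addr0 => /addrI/esym.
Qed.

Let restr_supp (u : 'cV[R]_p) : mask *m u = u -> forall i, i \notin S -> u i 0 = 0.
Proof. by move=> <- i iS; rewrite mask_mul restrE (negPf iS). Qed.

Let sqnorm_X (u v : 'cV[R]_p) : D *m u = v -> mask *m v = v -> sqnorm (X *m u) = dot u v.
Proof.
move=> Duv mv; have mu := supp_of_D Duv mv.
have := maskD u; rewrite Duv mv mu => ->.
by rewrite sqnormE dot_mulmx -{1}mu dot_mulmx trmx_mask.
Qed.

Lemma masked_gram_unit : D \in unitmx.
Proof.
rewrite -row_free_unit; apply: inj_row_free => v vD.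
have trD : D^T = D.
  rewrite /D /masked_gram linearD linearB/= !trmx_mul trmx1 trmxK trmx_mask.
  by rewrite !mulmxA.
have Dv : D *m v^T = 0 by rewrite -trD -trmx_mul vD linear0.
have mz : mask *m 0 = 0 :> 'cV[R]_p by rewrite mulmx0.
have := lowerX (restr_supp (supp_of_D Dv mz)).
rewrite (sqnorm_X Dv mz) (_ : dot _ 0 = 0); last first.
  by apply: big1 => i _; rewrite [X in _ * X]mxE mulr0.
rewrite pmulr_rle0// => v0; apply: trmx_inj; rewrite linear0; apply/eqP.
by rewrite -sqnorm_eq0 eq_le v0 sqnorm_ge0.
Qed.

Let invE : masked_gram_inv X = invmx D.
Proof. by rewrite /invmx masked_gram_unit. Qed.

Let delta_mask i : i \in S -> mask *m delta_mx i 0 = delta_mx i 0 :> 'cV[R]_p.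
Proof.
move=> iS; rewrite mask_mul restr_id// => j jS; rewrite mxE andbT.
by case: eqP => // ji; rewrite ji iS in jS.
Qed.

(** The weight is [X *m u] with [D *m u] the [i]-th basis vector, so its squared norm equals
    [a = u i 0]. Then [b * a ^ 2 <= b * sqnorm u <= a] forces [a <= 1 / b]. *)
Lemma sqnorm_ls_weight i : i \in S -> sqnorm (ls_weight X i) <= b^-1.
Proof.
move=> iS; rewrite /ls_weight invE.
pose u := invmx D *m delta_mx i 0 : 'cV[R]_p.
have Du : D *m u = delta_mx i 0 by rewrite /u mulmxA mulmxV ?masked_gram_unit ?mul1mx.
have mu := supp_of_D Du (delta_mask iS).
have -> : X *m mask *m invmx D *m delta_mx i 0 = X *m u by rewrite -!mulmxA -/u mu.
have := lowerX (restr_supp mu); rewrite (sqnorm_X Du (delta_mask iS)) dot_delta.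
set a := u i 0 => H; have ai : a ^+ 2 <= sqnorm u := sqr_coord_le u i.
rewrite -(@ler_pM2l _ b)// divff ?gt_eqF//.
have [a0|a0] := leP a 0; first by rewrite (le_trans _ ler01)// pmulr_rle0.
have : b * a ^+ 2 <= a by apply: le_trans H; rewrite ler_pM2l.
by rewrite expr2 mulrA -{3}[a]mul1r ler_pM2r.
Qed.

Lemma ls_weight_regression (eps : 'cV[R]_m) : exists nu : 'cV[R]_p,
  [/\ forall i, i \notin S -> nu i 0 = 0,
      forall i, i \in S -> (X^T *m (eps - X *m nu)) i 0 = 0
    & forall i, i \in S -> nu i 0 = dot (ls_weight X i) eps].
Proof.
pose v := mask *m (X^T *m eps); pose nu := invmx D *m v.
have Dnu : D *m nu = v by rewrite /nu mulmxA mulmxV ?masked_gram_unit ?mul1mx.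
have mv : mask *m v = v by rewrite /v mulmxA mask_idem.
have mnu := supp_of_D Dnu mv.
exists nu; split; first exact: restr_supp.
  move=> i iS; have := maskD nu; rewrite Dnu mv mnu /v !mask_mul => E.
  have := congr1 (fun z : 'cV[R]_p => z i 0) E; rewrite /= !restrE iS => E'.
  by rewrite mulmxBr [LHS]mxE [X in _ + X]mxE E' subrr.
move=> i iS; rewrite -dot_delta /nu /v 3!dot_mulmx trmxK trmx_mask [LHS]dotC.
congr (dot _ eps); rewrite /ls_weight invE -!mulmxA trmx_inv.
congr (_ *m (_ *m (invmx _ *m _))).
rewrite /D /masked_gram linearD linearB/= !trmx_mul trmx1 trmxK trmx_mask.
by rewrite !mulmxA.
Qed.

End LeastSquaresWeights.

Section UnionBound.
Context {R : realType} d (T : measurableType d) (mu : probability T R).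

Lemma union_bound (J : finType) (A : J -> set T) (q : pred J) (c : R) :
  (forall j, measurable (A j)) -> (forall j, q j -> (mu (A j) <= c%:E)%E) ->
  measurable [set t | exists2 j, q j & A j t] /\
  (mu [set t | exists2 j, q j & A j t] <= (#|q|%:R * c)%:E)%E.
Proof.
move=> mA cA.
suff H s : {subset s <= q} -> measurable [set t | exists2 j, j \in s & A j t] /\
    (mu [set t | exists2 j, j \in s & A j t] <= ((size s)%:R * c)%:E)%E.
  have sE : [set t | exists2 j, q j & A j t] = [set t | exists2 j, j \in enum q & A j t].
    by apply/seteqP; split => t [j jq Aj]; exists j => //; move: jq; rewrite mem_enum.
  rewrite sE cardE; apply: H => j; by rewrite mem_enum.
elim: s => [_|j s IH js].
  rewrite (_ : [set t | _] = set0); last by apply/seteqP; split => t // [].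
  by rewrite measure0 mul0r; split => //; exact: measurable0.
have [|ms mus] := IH; first by move=> k ks; apply: js; rewrite inE ks orbT.
rewrite (_ : [set t | _] = A j `|` [set t | exists2 j, j \in s & A j t]); last first.
  apply/seteqP; split => t /=.
    by move=> [k]; rewrite inE => /predU1P[->|ks] Ak; [left|right; exists k].
  move=> [Aj|[k ks Ak]]; first by exists j => //; rewrite mem_head.
  by exists k => //; rewrite inE ks orbT.
split; first exact: measurableU.
apply: le_trans (measureU2 mu (mA j) ms) _.
have := leeD (cA j (js j (mem_head j s))) mus; rewrite -EFinD => /le_trans; apply.
by rewrite lee_fin/= -natr1 mulrDl mul1r addrC.
Qed.

End UnionBound.

(** * The good event for the Gaussian design *)

Section GaussianDesign.
Context {R : realType} {m p : nat}.
Local Notation I := ('I_m * 'I_p + 'I_m)%type.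
Local Notation T := (#|{: I}|.-tuple R).

(** The noise is treated as one more column of the design, placed last. *)
Definition gidx (r : 'I_m) (j : 'I_(p + 1)) : I :=
  match fintype.split j with inl i => inl (r, i) | inr _ => inr r end.

Lemma gidx_inj r r' j j' : gidx r j = gidx r' j' -> r = r' /\ j = j'.
Proof.
rewrite /gidx -{2}(splitK j) -{2}(splitK j').
case: (fintype.split j) => a; case: (fintype.split j') => b // [].
  by move=> -> ->.
by move=> ->; rewrite (ord1 a) (ord1 b).
Qed.

Definition Zmx (t : T) : 'M[R]_(m, p) := \matrix_(r, j) entry (inl (r, j)) t.
Definition epsv (t : T) : 'cV[R]_m := \col_r entry (inr r) t.
Definition Gmx (t : T) : 'M[R]_(m, p + 1) := \matrix_(r, j) entry (gidx r j) t.

Lemma Gmx_mul_col t (u : 'cV[R]_p) (s : R) :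
  Gmx t *m col_mx u s%:M = Zmx t *m u + s *: epsv t.
Proof.
have -> : Gmx t = row_mx (Zmx t) (epsv t).
  apply/matrixP => r j; rewrite !mxE /gidx.
  by case: (fintype.split j) => i; rewrite mxE.
by rewrite mul_row_col mul_mx_scalar.
Qed.

Lemma sqnorm_Gmx t x : sqnorm (Gmx t *m x) = rowsq gidx (fun j => x j 0) t.
Proof.
apply: eq_bigr => r _; rewrite mxE; congr (_ ^+ 2).
by apply: eq_bigr => j _; rewrite mxE mulrC.
Qed.

Lemma sqnorm_col (u : 'cV[R]_p) (s : R) :
  sqnorm (col_mx u s%:M : 'cV[R]_(p + 1)) = sqnorm u + s ^+ 2.
Proof.
rewrite /sqnorm big_split_ord/= big_ord1; congr (_ + _).
  by apply: eq_bigr => i _; rewrite col_mxEu.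
by rewrite col_mxEd mxE eqxx.
Qed.

Lemma measurable_sqnorm_Gmx x : measurable_fun setT (fun t => sqnorm (Gmx t *m x)).
Proof. by under eq_fun do rewrite sqnorm_Gmx; exact: measurable_rowsq. Qed.

Context (mu : probability T R) (Hmu : std_gaussian mu).
Local Notation tailp := (expR (- (m%:R / 64)) : R).

Lemma Gmx_upper_tail x :
  (mu [set t | (2 * m%:R * sqnorm x < sqnorm (Gmx t *m x))%R] <= tailp%:E)%E.
Proof.
have := rowsq_upper_tail Hmu (fun j => x j 0) gidx_inj; rewrite card_ord.
by under [in X in X -> _]eq_set do rewrite -sqnorm_Gmx.
Qed.

Lemma Gmx_lower_tail x :
  (mu [set t | (sqnorm (Gmx t *m x) < 5 / 8 * m%:R * sqnorm x)%R] <= tailp%:E)%E.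
Proof.
have := rowsq_lower_tail Hmu (fun j => x j 0) gidx_inj; rewrite card_ord.
by under [in X in X -> _]eq_set do rewrite -sqnorm_Gmx.
Qed.

Lemma Gmx_restricted_lower K (B : 'M[R]_(p + 1, K)) : (0 < K)%N ->
  exists bad : set T, [/\ measurable bad,
    (mu bad <= ((2 ^+ (10 * K) * 4 ^+ K + K%:R) * tailp)%:E)%E &
    forall t, ~ bad t -> forall z, m%:R / 2 * sqnorm (B *m z) <= sqnorm (Gmx t *m (B *m z))].
Proof.
move=> K0; have [k [Q [U [kK QQ BE]]]] := gram_schmidt B.
pose h : R := (2 * Num.sqrt K%:R)^-1.
pose A1 (j : 'I_k) := [set t | 2 * m%:R * sqnorm (col j Q) < sqnorm (Gmx t *m col j Q)].
pose A2 (z : {ffun 'I_k -> bool * 'I_(10 * K).+1}) :=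
  [set t | sqnorm (Gmx t *m (Q *m latpt h z)) < 5 / 8 * m%:R * sqnorm (Q *m latpt h z)].
have mA1 j : measurable (A1 j).
  exact: measurable_strict_superlevel (measurable_sqnorm_Gmx _).
have mA2 z : measurable (A2 z).
  exact: measurable_strict_sublevel (measurable_sqnorm_Gmx _).
have [m1 b1] := union_bound (q := xpredT) mA1 (fun j _ => Gmx_upper_tail _).
have [m2 b2] := union_bound (q := mem (lattice k (10 * K))) mA2 (fun j _ => Gmx_lower_tail _).
exists ([set t | exists2 j, xpredT j & A1 j t] `|`
        [set t | exists2 z, z \in lattice k (10 * K) & A2 z t]); split.
- exact: measurableU.
- apply: le_trans (measureU2 mu m1 m2) (le_trans (leeD b1 b2) _).
  rewrite -EFinD lee_fin -mulrDl; apply: ler_wpM2r; first exact: expR_ge0.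
  rewrite addrC; apply: lerD; last first.
    by rewrite ler_nat (leq_trans _ kK)// -[leqRHS]card_ord max_card.
  apply: le_trans (card_lattice _ _) _; apply: ler_wpM2l; first exact: exprn_ge0.
  by apply: ler_weXn2l => //; lra.
- move=> t nbad z; have [n1 n2] : ~ (exists2 j, xpredT j & A1 j t) /\
      ~ (exists2 z, z \in lattice k (10 * K) & A2 z t).
    by split => H; apply: nbad; [left|right].
  rewrite BE -mulmxA (sqnorm_isometry _ QQ) mulmxA.
  apply: (@lattice_lower_bound R m k K _ m%:R _ kK K0 (ler0n _ _)) => [j|y yl].
    rewrite colE -mulmxA -colE leNgt; apply/negP => bj; apply: n1; exists j => //.
    rewrite /A1/= colE (sqnorm_isometry _ QQ) -colE.
    by rewrite [sqnorm (delta_mx j 0)]sqnormE dot_delta mxE !eqxx mulr1.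
  rewrite -mulmxA leNgt; apply/negP => by_; apply: n2; exists y => //.
  by rewrite /A2/= (sqnorm_isometry _ QQ).
Qed.

Variables (S : {set 'I_p}) (A : 'M[R]_p) (u : 'cV[R]_p) (sigma b r : R).
Hypotheses (b0 : 0 < b) (r0 : 0 < r).

Let Xof t := Zmx t *m A.
Let K := (#|S| + 1 + 1)%N.

Let Zmx_upd l y t : Zmx (upd (inr l) y t) = Zmx t.
Proof. by apply/matrixP => i j; rewrite !mxE entry_upd. Qed.

(** The truncation makes the squared norm at most [b] for every design, as the conditional tail
    requires. The weights depend on [t] through [Zmx t] only, so redrawing the noise leaves them
    unchanged. *)
Let weight i k t :=
  if sqnorm (ls_weight S (Xof t) i) <= b then ls_weight S (Xof t) i k 0 else 0.

Let measurable_weight i k : measurable_fun setT (weight i k).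
Proof.
have mX : mxmeasurable Xof.
  apply: mxmeasurable_mul; last exact: mxmeasurable_cst.
  by move=> a c; under eq_fun do rewrite mxE; exact: measurable_entry.
have mD : mxmeasurable (fun t => masked_gram S (Xof t)).
  apply: mxmeasurable_add; last exact: mxmeasurable_cst.
  apply: mxmeasurable_mul; last exact: mxmeasurable_cst.
  apply: mxmeasurable_mul => //; apply: mxmeasurable_mul.
    exact: mxmeasurable_cst.
  exact: mxmeasurable_trmx.
have mw : mxmeasurable (fun t => ls_weight S (Xof t) i).
  apply: mxmeasurable_mul; last exact: mxmeasurable_cst.
  apply: mxmeasurable_mul.
    by apply: mxmeasurable_mul => //; exact: mxmeasurable_cst.
  apply: mxmeasurable_scale; last exact: mxmeasurable_adj.
  by apply: measurable_invr; exact: measurable_det.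
apply: measurable_fun_ifT; last exact: measurable_cst; last exact: mw.
apply: measurable_fun_ler; last exact: measurable_cst.
by apply: measurable_sum => l; apply: measurable_funX; exact: mw.
Qed.

Let bad_noise i := [set t | r < `|\sum_k weight i k t * entry (inr k) t|].

Let bad_noise_tail i :
  (mu (bad_noise i) <= (2 * expR (- (r ^+ 2 / (2 * b))))%:E)%E.
Proof.
have inr_inj : injective (fun k : 'I_m => inr k : I) by move=> k l [].
have wupd k l y t : weight i k (upd (inr l) y t) = weight i k t.
  by rewrite /weight /Xof Zmx_upd.
have wb t : \sum_k weight i k t ^+ 2 <= b.
  rewrite /weight; have [wb|wb] := leP (sqnorm (ls_weight S (Xof t) i)) b.
    exact: wb.
  by rewrite big1 ?ltW// => k _; rewrite expr0n.
exact: (conditional_gaussian_tail Hmu inr_inj (measurable_weight i) wupd wb b0 r0).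
Qed.

Let measurable_bad_noise i : measurable (bad_noise i).
Proof.
apply: measurable_strict_superlevel; apply: measurableT_comp => //.
apply: measurable_sum => k; apply: measurable_funM; first exact: measurable_weight.
exact: measurable_entry.
Qed.

(** The first bound is used with [c = s = 0] for the restricted eigenvalue, and with [c = 1],
    [s = sigma] for the residual variance. *)
Lemma gaussian_design_event : exists bad : set T, [/\ measurable bad,
  (mu bad <= ((2 ^+ (10 * K) * 4 ^+ K + K%:R + 2) * tailp
     + #|S|%:R * (2 * expR (- (r ^+ 2 / (2 * b)))))%:E)%E &
  forall t, ~ bad t ->
  [/\ forall (v : 'cV[R]_p) c s, (forall i, i \notin S -> v i 0 = 0) ->
        m%:R / 2 * (sqnorm (A *m (v + c *: u)) + s ^+ 2)
        <= sqnorm (Xof t *m (v + c *: u) + s *: epsv t),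
      sqnorm (Xof t *m u) <= 2 * m%:R * sqnorm (A *m u),
      sqnorm (Xof t *m u + sigma *: epsv t) <= 2 * m%:R * (sqnorm (A *m u) + sigma ^+ 2) &
      forall i, i \in S -> sqnorm (ls_weight S (Xof t) i) <= b ->
        `|dot (ls_weight S (Xof t) i) (epsv t)| <= r]].
Proof.
(* [E] embeds the coordinates of [S]. The three blocks of [B] are the columns in [S], the direction
   [u] and the noise, so [B *m z] reaches every vector to which the lower bound is applied. *)
pose E : 'M[R]_(p, #|S|) := \matrix_(i, k) (i == enum_val k)%:R.
pose B : 'M[R]_(p + 1, K) :=
  row_mx (row_mx (col_mx (A *m E) 0) (col_mx (A *m u) 0)) (col_mx 0 1%:M).
have [bad1 [mb1 pb1 gb1]] := Gmx_restricted_lower B (ltn_addl _ (ltn0Sn 0)).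
pose x1 := col_mx (A *m u) 0%:M : 'cV[R]_(p + 1).
pose x2 := col_mx (A *m u) sigma%:M : 'cV[R]_(p + 1).
pose bad2 x := [set t | 2 * m%:R * sqnorm x < sqnorm (Gmx t *m x)].
have mb2 x : measurable (bad2 x).
  exact: measurable_strict_superlevel (measurable_sqnorm_Gmx _).
have [mb3 pb3] := union_bound (q := mem S) measurable_bad_noise (fun i _ => bad_noise_tail i).
set bad3 := [set t | _] in mb3 pb3.
exists ((bad1 `|` (bad2 x1 `|` bad2 x2)) `|` bad3); split.
- by apply: measurableU => //; apply: measurableU => //; apply: measurableU.
- apply: le_trans (measureU2 mu _ mb3) _.
    by apply: measurableU => //; apply: measurableU.
  rewrite EFinD; apply: leeD => //.
  apply: le_trans (measureU2 mu mb1 (measurableU _ _ (mb2 x1) (mb2 x2))) _.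
  rewrite mulrDl EFinD; apply: leeD => //.
  apply: le_trans (measureU2 mu (mb2 x1) (mb2 x2)) _.
  apply: le_trans (leeD (Gmx_upper_tail x1) (Gmx_upper_tail x2)) _.
  by rewrite -EFinD lee_fin; lra.
- move=> t nb; have [n1 n2 n3 n4] : [/\ ~ bad1 t, ~ bad2 x1 t, ~ bad2 x2 t & ~ bad3 t].
    by split => H; apply: nb; [left; left|left; right; left|left; right; right|right].
  have GE (v : 'cV[R]_p) s : Gmx t *m col_mx (A *m v) s%:M = Xof t *m v + s *: epsv t.
    by rewrite Gmx_mul_col mulmxA.
  split.
  + move=> v c s vS.
    pose z : 'cV[R]_K := col_mx (col_mx (\col_k v (enum_val k) 0) c%:M) s%:M.
    have Bz : B *m z = col_mx (A *m (v + c *: u)) s%:M.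
      rewrite /B /z !mul_row_col !mul_col_mx !mul_mx_scalar !mul0mx.
      rewrite !scaler0 !add_col_mx !addr0 add0r scalemx1; congr col_mx.
      rewrite mulmxDr -scalemxAr -mulmxA; congr (_ *m _ + _).
      apply/matrixP => i j; rewrite ord1 mxE.
      have [iS|iS] := boolP (i \in S); last first.
        rewrite vS// big1// => k _; rewrite !mxE; case: eqP => [ik|]; last by rewrite mul0r.
        by rewrite ik enum_valP in iS.
      rewrite (bigD1 (enum_rank_in iS i))//= !mxE enum_rankK_in// eqxx mul1r.
      rewrite big1 ?addr0// => k ki; rewrite !mxE; case: eqP => [ik|]; last by rewrite mul0r.
      by case/eqP: ki; apply: enum_val_inj; rewrite enum_rankK_in.
    by have := gb1 t n1 z; rewrite Bz sqnorm_col GE.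
  + have := n2; rewrite /bad2/= => /negP; rewrite -leNgt GE sqnorm_col scale0r addr0.
    by rewrite expr0n addr0.
  + by have := n3; rewrite /bad2/= => /negP; rewrite -leNgt GE sqnorm_col.
  + move=> i iS wb; rewrite leNgt; apply/negP => ri; apply: n4; exists i => //.
    rewrite /bad_noise/=; apply: lt_le_trans ri _; rewrite le_eqVlt; apply/orP; left.
    apply/eqP; congr `|_|; apply: eq_bigr => k _; rewrite /weight wb.
    by rewrite [epsv t k 0]mxE.
Qed.

End GaussianDesign.

(** * Numerical inequalities *)

Section Numeric.
Context {R : realType}.

(** From [expR (- 1/8) >= 7/8], the number [e] is at most [(8/7) ^ 8], about 2.91. This is what
    gives [ln p >= 1] for [p >= 3]. *)
Lemma expR1_le3 : expR 1 <= 3 :> R.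
Proof.
have -> : expR 1 = expR (8%:R^-1) ^+ 8 :> R by rewrite -expRM_natl mulfV.
have e0 := expR_ge0 (8%:R^-1 : R).
have ee : expR 8%:R^-1 * expR (- 8%:R^-1) = 1 :> R by rewrite -expRD subrr expR0.
have e1 := expR_ge1Dx (- 8%:R^-1 : R).
have e2 : expR 8%:R^-1 <= 8 / 7 :> R by nra.
apply: (@le_trans _ _ ((8 / 7) ^+ 8)); last by lra.
by apply: lerXn2r; rewrite ?nnegrE//; lra.
Qed.

Lemma ln_ge1 (x : R) : 3 <= x -> 1 <= ln x.
Proof.
move=> x3; rewrite -(@expRK R 1) ler_ln ?posrE ?expR_gt0//; last lra.
exact: le_trans expR1_le3 x3.
Qed.

(** With [K = k + 2] the prefactor is at most [2 ^ (12 K + 1)], hence at most [expR (12 k + 25)],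
    while [M / 64] is at least [40 * (s + l)]; this fixes the constant [2560 = 64 * 40]. *)
Lemma net_tail_le (s l M : R) (k : nat) : k%:R <= s -> 1 <= l ->
  2560 * (s + l) <= M ->
  (2 ^+ (10 * (k + 1 + 1)) * 4 ^+ (k + 1 + 1) + (k + 1 + 1)%:R + 2) * expR (- (M / 64))
  <= expR (- l).
Proof.
move=> ks l1 M1; set K := (k + 1 + 1)%N.
have K2 : (2 <= K)%N by rewrite /K -addnA leq_addl.
have p2 : (2 : R) ^+ (10 * K) * 4 ^+ K = 2 ^+ (12 * K).
  rewrite (_ : 4 = 2 ^+ 2 :> R); last by rewrite expr2; lra.
  by rewrite -exprM -exprD; congr (_ ^+ _); rewrite -mulnDl.
have pK : K%:R + 2 <= 2 ^+ (12 * K) :> R.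
  rewrite -natrX -natrD ler_nat (leq_trans (_ : _ <= 2 * K))%N//.
    by rewrite mul2n -addnn leq_add2l.
  rewrite (leq_trans (_ : _ <= 2 * 2 ^ K))%N// ?leq_mul2l/= ?(ltnW (ltn_expl _ _))//.
  by rewrite -expnS leq_exp2l// mulSn -addn1 leq_add2l muln_gt0/= (leq_trans _ K2).
have e2 : 2 <= expR 1 :> R by have := expR_ge1Dx (1 : R); lra.
rewrite -addrA p2; apply: (@le_trans _ _ (expR 1 ^+ (12 * K).+1 * expR (- (M / 64)))).
  apply: ler_wpM2r; first exact: expR_ge0.
  apply: (@le_trans _ _ (2 ^+ (12 * K).+1)); first by rewrite exprS; lra.
  by apply: lerXn2r; rewrite ?nnegrE ?expR_ge0//.
rewrite -expRM_natl -expRD ler_expR mulr1 -natr1 natrM.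
by rewrite /K !natrD; have := ler0n R k; lra.
Qed.

End Numeric.

End Development.

(** * Probability of the good event and conclusion *)

Theorem theorem2 (R : realType) :
  exists c : R, forall eta : R, 1 < eta ->
  exists c_eta : R,
  forall (p m k0 : nat), (3 <= p)%N -> (0 < m)%N ->
  forall (theta : 'cV[R]_p) (sigma : R) (Sigma : 'M[R]_p) (delta a1 a2 a3 : R)
         (S : {set 'I_p}) (cstar : R),
    0 < sigma -> Ueta eta Sigma -> 0 < delta < 1 ->
    0 < a1 -> 0 < a2 -> 0 < a3 ->
    c * (a2 * (l0norm theta)%:R + ln (4 / delta)) <= m%:R ->
    propS m theta sigma a1 a2 a3 S ->
    Num.sqrt 2 * a1
      + 11 * eta ^+ 2 * Num.max a3 1 * Num.sqrt (ln (4 * expR 1 / delta))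
      <= cstar ->
  (* the least squares estimator on S (any selection of the argmin) *)
  forall est : 'M[R]_(m, p) -> 'cV[R]_m -> 'cV[R]_p,
    ls_selection S est ->
  (* the data: X = Z A with A^T A = Sigma (rows i.i.d. N(0, Sigma)),
     Y = X theta + sigma eps, where the entries of Z and eps are
     mutually independent standard Gaussians on a probability space *)
  forall (d : measure_display) (Omega : measurableType d)
         (P : probability Omega R)
         (g : ('I_m * 'I_p + 'I_m)%type -> Omega -> R)
         (A : 'M[R]_p),
    iid_std_normal P g ->
    A^T *m A = Sigma ->
  let X := fun w : Omega => (\matrix_(i < m, j < p) g (inl (i, j)) w) *m A in
  let Y := fun w : Omega =>
             X w *m theta + sigma *: (\col_(i < m) g (inr i) w) in
  let reject := [set w : Omega | phi_th k0 est cstar (X w) (Y w)] in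
  ((l0norm theta <= k0)%N ->
     exists E : set Omega, measurable E /\ reject `<=` E /\
       (P E <= delta%:E)%E) /\
  ((k0 < l0norm theta)%N ->
     d2 theta (B0 k0) ^+ 2 >=
       c_eta * (1 + a3 ^+ 2 * (l0norm theta)%:R * ln (p%:R) / m%:R)
         * (a3 ^+ 2 * Num.sqrt (ln (4 / delta)) + cstar ^+ 2)
         * sigma ^+ 2 * (((l0norm theta)%:R - k0%:R) * ln (p%:R)) / m%:R ->
     exists E : set Omega, measurable E /\ E `<=` reject /\
       ((1 - delta)%:E <= P E)%E).
Proof.
exists 2560 => eta eta1; exists (23 * eta ^+ 2).
case=> [//|n] m k0 p3 m0 theta sigma Sigma delta a1 a2 a3 S cstar.
move=> sigma0 USigma /andP[delta0 delta1] a10 _ a30 m_ge thetaS cstar_ge est est_ls.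
move=> d Omega P g A iid AA X Y reject.
have eta0 : 0 < eta := lt_trans ltr01 eta1.
have M0 : 0 < m%:R :> R by rewrite ltr0n.
have d4 : 0 < 4 / delta by rewrite divr_gt0.
have d44 : 4 < 4 / delta by rewrite ltr_pdivlMr// gtr_pMr.
set l := ln (4 / delta) in m_ge *.
have l1 : 1 <= l by apply: ln_ge1; lra.
have el : expR l = 4 / delta by rewrite lnK.
set L := Num.sqrt (ln (4 * expR 1 / delta)) in cstar_ge.
have L2 : L ^+ 2 = 1 + l.
  rewrite /L (_ : 4 * expR 1 / delta = expR 1 * (4 / delta)); last first.
    by field; rewrite gt_eqF.
  by rewrite lnM ?posrE ?expR_gt0// expRK sqr_sqrtr// -/l; lra.
have L1 : 1 <= L.
  by rewrite -(@ler_pXn2r _ 2) ?nnegrE ?sqrtr_ge0// expr1n L2; lra.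
have lnp1 : 1 <= ln (n.+1%:R : R) by apply: ln_ge1; rewrite ler_nat.
have rt2 : rate n.+1 m ^+ 2 = ln (n.+1%:R) / m%:R :> R.
  by rewrite sqr_sqrtr// divr_ge0 ?ler0n//; lra.
have rt0 : 0 < rate n.+1 m :> R by rewrite sqrtr_gt0 divr_gt0//; lra.
(* [b] is the inverse of the restricted eigenvalue bound [m / (2 * eta)], hence a bound on the
   squared weights; [r] is the noise level of [nu_le]. *)
pose b := 2 * eta / m%:R; pose r := 2 * eta * L * rate n.+1 m.
have b0 : 0 < b by rewrite divr_gt0// mulr_gt0.
have r0 : 0 < r by rewrite !mulr_gt0//; lra.
have [mG [mu Hmu muP]] := iid_std_gaussian iid.
set tail := restr (~: S) theta.
have [bad [mbad pbad good]] := gaussian_design_event Hmu S A tail sigma b0 r0.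
have bad_le : (mu bad <= delta%:E)%E.
  apply: le_trans pbad _; rewrite lee_fin.
  have net : (2 ^+ (10 * (#|S| + 1 + 1)) * 4 ^+ (#|S| + 1 + 1) + (#|S| + 1 + 1)%:R + 2)
      * expR (- (m%:R / 64)) <= expR (- l) :> R.
    by apply: (net_tail_le _ l1 m_ge); case: thetaS.
  (* The exponent is [eta * L ^ 2 * ln p], with [L ^ 2 = 1 + l]; it is at least [ln p + l], and
     [ln p] pays for the union over [S]. *)
  have noise : #|S|%:R * (2 * expR (- (r ^+ 2 / (2 * b)))) <= 2 * expR (- l) :> R.
    have -> : r ^+ 2 / (2 * b) = eta * L ^+ 2 * ln (n.+1%:R).
      by rewrite /r /b !exprMn rt2; field; rewrite !gt_eqF.
    have Sn : #|S|%:R <= n.+1%:R :> R by rewrite ler_nat -[leqRHS]card_ord max_card.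
    have pE : expR (- ln (n.+1%:R)) * n.+1%:R = 1 :> R.
      by rewrite expRN lnK ?posrE ?ltr0n// mulVf// pnatr_eq0.
    apply: (@le_trans _ _ (n.+1%:R * (2 * expR (- ln (n.+1%:R) - l)))).
      apply: ler_pM; [exact: ler0n|by rewrite mulr_ge0 ?expR_ge0|exact: Sn|].
      apply: ler_wpM2l => //; rewrite ler_expR -opprD lerN2 L2.
      have h1 : ln n.+1%:R + l <= (1 + l) * ln n.+1%:R :> R.
        by rewrite mulrDl mul1r lerD2l ler_peMr//; lra.
      apply: (le_trans h1); apply: ler_wpM2r; first lra.
      by rewrite ler_peMl ?ltW//; lra.
    rewrite expRD (_ : n.+1%:R * _ = 2 * (expR (- ln n.+1%:R) * n.+1%:R) * expR (- l)); last by ring.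
    by rewrite pE mulr1.
  (* The total is [3 * expR (- l) = 3 * delta / 4]. *)
  apply: le_trans (lerD net noise) _; rewrite expRN el invf_div; lra.
have mE : measurable (gather g @^-1` bad) by rewrite -[X in measurable X]setTI; exact: mG.
have PE : (P (gather g @^-1` bad) <= delta%:E)%E by rewrite -muP.
have XE w : X w = Zmx (gather g w) *m A.
  by rewrite /X; congr (_ *m A); apply/matrixP => i j; rewrite !mxE entry_gather.
have epsE w : (\col_(i < m) g (inr i) w) = epsv (gather g w).
  by apply/matrixP => i j; rewrite !mxE entry_gather.
have quad v := Ueta_sqnorm v USigma AA.
have design w : ~ (gather g @^-1` bad) w -> exists nu : 'cV[R]_n.+1,
  [/\ (forall v : 'cV[R]_n.+1, (forall i, i \notin S -> v i 0 = 0) ->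
        m%:R / 2 * (eta^-1 * sqnorm v) <= sqnorm (X w *m v)),
      (forall v : 'cV[R]_n.+1, (forall i, i \notin S -> v i 0 = 0) ->
        m%:R / 2 * sigma ^+ 2 <= sqnorm (X w *m (v + tail) + sigma *: (\col_(i < m) g (inr i) w))),
      sqnorm (X w *m tail) <= 2 * m%:R * (eta * sqnorm tail) &
      sqnorm (X w *m tail + sigma *: (\col_(i < m) g (inr i) w))
        <= 2 * m%:R * (eta * sqnorm tail + sigma ^+ 2)] /\
  [/\ forall i, i \notin S -> nu i 0 = 0,
      forall i, i \in S -> ((X w)^T *m ((\col_(i < m) g (inr i) w) - X w *m nu)) i 0 = 0 &
      forall i, `|nu i 0| <= 2 * eta * L * rate n.+1 m].
  rewrite epsE XE => /good[g1 g2 g3 g4]; set e := epsv _; set Xw := Zmx _ *m A in g1 g2 g3 g4 *.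
  have low (v : 'cV[R]_n.+1) : (forall i, i \notin S -> v i 0 = 0) ->
      m%:R / 2 * (eta^-1 * sqnorm v) <= sqnorm (Xw *m v).
    move=> vS; have := g1 v 0 0 vS; rewrite !scale0r !addr0 expr0n addr0.
    apply: le_trans; apply: ler_wpM2l; first by rewrite divr_ge0.
    by have [] := quad v.
  have low' (v : 'cV[R]_n.+1) : (forall i, i \notin S -> v i 0 = 0) ->
      b^-1 * sqnorm v <= sqnorm (Xw *m v).
    move=> /low; apply: le_trans; rewrite le_eqVlt; apply/orP; left; apply/eqP.
    by rewrite /b; field; rewrite !gt_eqF.
  have bi0 : 0 < b^-1 by rewrite invr_gt0.
  have [nu [nu1 nu2 nu3]] := ls_weight_regression bi0 low' e.
  exists nu; split; split => //.
  - move=> v vS; have := g1 v 1 sigma vS; rewrite scale1r; apply: le_trans.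
    apply: ler_wpM2l; first by rewrite divr_ge0.
    by rewrite lerDr sqnorm_ge0.
  - apply: le_trans g2 _; apply: ler_wpM2l; first by rewrite mulr_ge0.
    by have [] := quad tail.
  - apply: le_trans g3 _; apply: ler_wpM2l; first by rewrite mulr_ge0.
    by rewrite lerD2r; have [] := quad tail.
  - move=> i; have [iS|iS] := boolP (i \in S); last first.
      by rewrite nu1// normr0 -/r ltW.
    rewrite nu3//; apply: g4 => //; rewrite -[leRHS]invrK.
    exact: sqnorm_ls_weight.
(* [est] is an arbitrary selection, so [reject] need not be measurable: the preimage of [bad]
   encloses it in the first case, and the complement of that preimage lies inside it in the
   second. *)
split=> [qk|kq d2_ge].
  exists (gather g @^-1` bad); split=> //; split=> // w rw.
  apply: contrapT => /design[nu [[h1 h2 h3 h4] [h5 h6 h7]]].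
  have := good_design_level (k0 := k0) m0 p3 sigma0 eta1 a10 a30 L1 thetaS cstar_ge
    est_ls h1 h2 h3 h5 h6 h7 qk.
  by move/negP; apply; exact: rw.
exists (~` (gather g @^-1` bad)); split; first exact: measurableC.
split; last first.
  rewrite probability_setC// EFinB; apply: leeB => //.
move=> w /design[nu [[h1 h2 h3 h4] [h5 h6 h7]]].
apply: (good_design_power (k0 := k0) m0 p3 sigma0 eta1 a10 a30 L1 thetaS cstar_ge
    est_ls h1 h2 h3 h4 h5 h6 h7 kq).
apply: le_trans d2_ge; rewrite rt2.
set q := (l0norm theta)%:R.
have q0 : 0 <= q - k0%:R by rewrite subr_ge0 ler_nat ltnW.
pose F := 23 * eta ^+ 2 * (1 + a3 ^+ 2 * q * (ln n.+1%:R / m%:R)) * sigma ^+ 2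
  * ((q - k0%:R) * (ln n.+1%:R / m%:R)).
have F0 : 0 <= F.
  have lnm0 : 0 <= ln n.+1%:R / m%:R :> R by rewrite divr_ge0 ?ler0n//; lra.
  have a3q : 0 <= a3 ^+ 2 * q * (ln n.+1%:R / m%:R).
    exact: mulr_ge0 (mulr_ge0 (sqr_ge0 _) (ler0n _ _)) lnm0.
  apply: mulr_ge0; last exact: mulr_ge0.
  apply: mulr_ge0; last exact: sqr_ge0.
  apply: mulr_ge0; first exact: mulr_ge0 (ler0n _ 23) (sqr_ge0 _).
  by rewrite addr_ge0.
have m_neq0 : m%:R != 0 :> R by rewrite gt_eqF.
rewrite [leLHS](_ : _ = F * cstar ^+ 2); last by rewrite /F; ring.
rewrite [leRHS](_ : _ = F * (a3 ^+ 2 * Num.sqrt l + cstar ^+ 2)); last first.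
  by rewrite /F; field; exact: m_neq0.
apply: ler_wpM2l => //; rewrite lerDr; apply: mulr_ge0; first exact: sqr_ge0.
exact: sqrtr_ge0.
Qed.
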